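(* Let $u:\bar\Delta_n\to\mathbb{R}^N$ be an extremizer (minimizer or maximizer) of $$\mathcal{J}[u]=\int_{\Delta_n}F\big(t,u(t),\nabla^{\boldsymbol\alpha}_{B_{P^1}}u(t),\nabla u(t)\big)\,dt_n\cdots dt_1$$ among all $u\in C^1(\bar\Delta_n;\mathbb{R}^N)$ such that each $B^{\alpha_i}_{P^1_{t_i}}u$ is continuous on $\bar\Delta_n$ and $u=\psi$ on $\partial\Delta_n$, where $\psi:\partial\Delta_n\to\mathbb{R}^N$ is given. Assume that for all $i,k$, $K^{1-\alpha_i}_{P^{1*}_{t_i}}\big(\partial_{v_{k,i}}F\{u\}\big)\in C^1(\bar\Delta_n)$ and $t\mapsto\partial_{w_{k,i}}F\{u\}(t)$ belongs to $C^1(\bar\Delta_n)$. Then for each $k=1,\dots,N$ and all $t\in\Delta_n$, $$\sum_{i=1}^n\Big[A^{\alpha_i}_{P^{1*}_{t_i}}\Big(\partial_{v_{k,i}}F\{u\}\Big)(t)+\frac{\partial}{\partial t_i}\Big(\partial_{w_{k,i}}F\{u\}\Big)(t)\Big]=\partial_{x_k}F\{u\}(t).$$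
   Context: Fix $n,N\in\mathbb{N}$, real numbers $a_i<b_i$, $\Delta_n=(a_1,b_1)\times\cdots\times(a_n,b_n)$ with closure $\bar\Delta_n$, $t=(t_1,\dots,t_n)$. For each order $\gamma\in(0,1)$ a kernel $k_\gamma$ is given, a difference kernel: $k_\gamma(s,\tau)=k_\gamma(s-\tau)$. A parameter set is $P_{t_i}=\langle a_i,t_i,b_i,p_i,q_i\rangle$ ($p_i,q_i\in\mathbb{R}$), with dual $P^*_{t_i}=\langle a_i,t_i,b_i,q_i,p_i\rangle$. For $f:\bar\Delta_n\to\mathbb{R}$: $K^{\gamma}_{P_{t_i}}f(t)=p_i\int_{a_i}^{t_i}k_\gamma(t_i-\tau)f(t_1,\dots,\tau,\dots,t_n)d\tau+q_i\int_{t_i}^{b_i}k_\gamma(\tau-t_i)f(t_1,\dots,\tau,\dots,t_n)d\tau$ ($\tau$ in the $i$-th slot); $A^{\alpha}_{P_{t_i}}f=\frac{\partial}{\partial t_i}K^{1-\alpha}_{P_{t_i}}f$; $B^{\alpha}_{P_{t_i}}f=K^{1-\alpha}_{P_{t_i}}\frac{\partial f}{\partial t_i}$; componentwise on vector functions. Here $\boldsymbol\alpha\in(0,1)^n$, $P^1=(P^1_{t_1},\dots,P^1_{t_n})$ with $P^1_{t_i}=\langle a_i,t_i,b_i,p^1_i,q^1_i\rangle$, and $k_{1-\alpha_i}\in L_1((0,b_i-a_i);\mathbb{R})$. $\nabla^{\boldsymbol\alpha}_{B_{P^1}}u$ is the $N\times n$ array with entries $B^{\alpha_i}_{P^1_{t_i}}u_k$,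 and $\nabla u$ the $N\times n$ array of classical partial derivatives $\partial u_k/\partial t_i$. $F(t,x,v,w)$, with $t\in\bar\Delta_n$, $x\in\mathbb{R}^N$, $v=(v_{k,i}),w=(w_{k,i})\in\mathbb{R}^{N\times n}$, is of class $C^2$; $F\{u\}(t)$ denotes evaluation at $(t,u(t),\nabla^{\boldsymbol\alpha}_{B_{P^1}}u(t),\nabla u(t))$. *)

(* Defs.v *)
From HB Require Import structures.
From mathcomp Require Import all_boot all_order all_algebra.
From mathcomp Require Import all_classical all_reals all_analysis.
Set Implicit Arguments. Unset Strict Implicit. Unset Printing Implicit Defensive.
Import Order.TTheory GRing.Theory Num.Theory numFieldNormedType.Exports.
Local Open Scope classical_set_scope.
Local Open Scope ring_scope.

Definition upd (R : realType) (n : nat) (t : 'rV[R]_n) (i : 'I_n) (s : R)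
  : 'rV[R]_n := \row_j (if j == i then s else t 0 j).

Definition updm (R : realType) (N n : nat) (m : 'M[R]_(N, n)) (k : 'I_N)
  (i : 'I_n) (s : R) : 'M[R]_(N, n) :=
  \matrix_(k', i') (if (k' == k) && (i' == i) then s else m k' i').

Definition obox (R : realType) (n : nat) (a b : 'rV[R]_n) : set 'rV[R]_n :=
  [set t | forall i, a 0 i < t 0 i < b 0 i].
Definition cbox (R : realType) (n : nat) (a b : 'rV[R]_n) : set 'rV[R]_n :=
  [set t | forall i, a 0 i <= t 0 i <= b 0 i].

(* derivative of g : R -> R at x relative to the set D (one-sided at the
   endpoints of an interval, the ordinary derivative at interior points) *)
Definition dquot (R : realType) (g : R -> R) (x : R) : R -> R :=
  fun h => h^-1 * (g (x + h) - g x).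
Definition dfilter (R : realType) (D : set R) (x : R) : set_system R :=
  within [set h | D (x + h)] (0 : R)^'.
Definition deriv_within (R : realType) (D : set R) (g : R -> R) (x : R) : R :=
  lim (dquot g x @ dfilter D x).
Definition derivable_within (R : realType) (D : set R) (g : R -> R) (x : R)
  : Prop := cvg (dquot g x @ dfilter D x).

Definition pd (R : realType) (n : nat) (a b : 'rV[R]_n) (f : 'rV[R]_n -> R)
  (i : 'I_n) (t : 'rV[R]_n) : R :=
  deriv_within `[a 0 i, b 0 i] (fun s => f (upd t i s)) (t 0 i).

Definition C1_box (R : realType) (n : nat) (a b : 'rV[R]_n) (f : 'rV[R]_n -> R)
  : Prop :=
  {within cbox a b, continuous f} /\
  forall i, (forall t, cbox a b t ->
               derivable_within `[a 0 i, b 0 i] (fun s => f (upd t i s)) (t 0 i))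
            /\ {within cbox a b, continuous (pd a b f i)}.

(* Kernel operator K^gamma_{P_{t_i}} with kernel kg = k_gamma (difference kernel),
   P_{t_i} = <a_i, t_i, b_i, p, q> *)
Definition Kop (R : realType) (n : nat) (a b : 'rV[R]_n) (kg : R -> R) (p q : R)
  (i : 'I_n) (f : 'rV[R]_n -> R) (t : 'rV[R]_n) : R :=
  p * (\int[@lebesgue_measure R]_(tau in `[a 0 i, t 0 i]) (kg (t 0 i - tau) * f (upd t i tau)))
  + q * (\int[@lebesgue_measure R]_(tau in `[t 0 i, b 0 i]) (kg (tau - t 0 i) * f (upd t i tau))).

Definition Aop (R : realType) (n : nat) (a b : 'rV[R]_n) (k : R -> R -> R)
  (alpha p q : R) (i : 'I_n) (f : 'rV[R]_n -> R) : 'rV[R]_n -> R :=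
  pd a b (Kop a b (k (1 - alpha)) p q i f) i.

Definition Bop (R : realType) (n : nat) (a b : 'rV[R]_n) (k : R -> R -> R)
  (alpha p q : R) (i : 'I_n) (f : 'rV[R]_n -> R) : 'rV[R]_n -> R :=
  Kop a b (k (1 - alpha)) p q i (pd a b f i).

Definition comp (R : realType) (n N : nat) (u : 'rV[R]_n -> 'rV[R]_N) (k : 'I_N)
  : 'rV[R]_n -> R := fun t => u t 0 k.

Definition fgrad (R : realType) (n N : nat) (a b : 'rV[R]_n) (k : R -> R -> R)
  (alpha p1 q1 : 'I_n -> R) (u : 'rV[R]_n -> 'rV[R]_N) (t : 'rV[R]_n)
  : 'M[R]_(N, n) :=
  \matrix_(kk, i) Bop a b k (alpha i) (p1 i) (q1 i) i (comp u kk) t.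

Definition cgrad (R : realType) (n N : nat) (a b : 'rV[R]_n)
  (u : 'rV[R]_n -> 'rV[R]_N) (t : 'rV[R]_n) : 'M[R]_(N, n) :=
  \matrix_(kk, i) pd a b (comp u kk) i t.

Definition args (R : realType) (n N : nat) : Type :=
  ('rV[R]_n * 'rV[R]_N * 'M[R]_(N, n) * 'M[R]_(N, n))%type.

(* scalar variables of F: t_i, x_k, v_{k,i}, w_{k,i} *)
Inductive fvar (n N : nat) : Type :=
  | Vt of 'I_n | Vx of 'I_N | Vv of 'I_N & 'I_n | Vw of 'I_N & 'I_n.
Arguments Vt {n N}. Arguments Vx {n N}. Arguments Vv {n N}. Arguments Vw {n N}.

Definition getv (R : realType) (n N : nat) (z : args R n N) (c : fvar n N) : R :=
  match c with
  | Vt i => z.1.1.1 0 i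
  | Vx k => z.1.1.2 0 k
  | Vv k i => z.1.2 k i
  | Vw k i => z.2 k i
  end.

Definition setv (R : realType) (n N : nat) (z : args R n N) (c : fvar n N) (s : R)
  : args R n N :=
  match c with
  | Vt i => (upd z.1.1.1 i s, z.1.1.2, z.1.2, z.2)
  | Vx k => (z.1.1.1, upd z.1.1.2 k s, z.1.2, z.2)
  | Vv k i => (z.1.1.1, z.1.1.2, updm z.1.2 k i s, z.2)
  | Vw k i => (z.1.1.1, z.1.1.2, z.1.2, updm z.2 k i s)
  end.

Definition vdom (R : realType) (n N : nat) (a b : 'rV[R]_n) (c : fvar n N) : set R :=
  match c with
  | Vt i => `[a 0 i, b 0 i]
  | _ => setT
  end.

Definition Fdom (R : realType) (n N : nat) (a b : 'rV[R]_n) : set (args R n N) :=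
  [set z | cbox a b z.1.1.1].

Definition pdF (R : realType) (n N : nat) (a b : 'rV[R]_n) (c : fvar n N)
  (G : args R n N -> R) (z : args R n N) : R :=
  deriv_within (vdom a b c) (fun s => G (setv z c s)) (getv z c).

Definition C1_F (R : realType) (n N : nat) (a b : 'rV[R]_n) (G : args R n N -> R)
  : Prop :=
  {within Fdom a b, continuous G} /\
  forall c : fvar n N,
    (forall z, Fdom a b z ->
       derivable_within (vdom a b c) (fun s => G (setv z c s)) (getv z c)) /\
    {within Fdom a b, continuous (pdF a b c G)}.

Definition C2_F (R : realType) (n N : nat) (a b : 'rV[R]_n) (G : args R n N -> R)
  : Prop := C1_F a b G /\ forall c : fvar n N, C1_F a b (pdF a b c G).

Definition uncurryF (R : realType) (n N : nat)
  (F : 'rV[R]_n -> 'rV[R]_N -> 'M[R]_(N, n) -> 'M[R]_(N, n) -> R) : args R n N -> R :=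
  fun z => F z.1.1.1 z.1.1.2 z.1.2 z.2.

Definition argu (R : realType) (n N : nat) (a b : 'rV[R]_n) (k : R -> R -> R)
  (alpha p1 q1 : 'I_n -> R) (u : 'rV[R]_n -> 'rV[R]_N) (t : 'rV[R]_n) : args R n N :=
  (t, u t, fgrad a b k alpha p1 q1 u t, cgrad a b u t).

Definition Fu (R : realType) (n N : nat) (a b : 'rV[R]_n) (k : R -> R -> R)
  (alpha p1 q1 : 'I_n -> R)
  (F : 'rV[R]_n -> 'rV[R]_N -> 'M[R]_(N, n) -> 'M[R]_(N, n) -> R)
  (u : 'rV[R]_n -> 'rV[R]_N) : 'rV[R]_n -> R :=
  fun t => F t (u t) (fgrad a b k alpha p1 q1 u t) (cgrad a b u t).

Definition dFu (R : realType) (n N : nat) (a b : 'rV[R]_n) (k : R -> R -> R)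
  (alpha p1 q1 : 'I_n -> R)
  (F : 'rV[R]_n -> 'rV[R]_N -> 'M[R]_(N, n) -> 'M[R]_(N, n) -> R)
  (c : fvar n N) (u : 'rV[R]_n -> 'rV[R]_N) : 'rV[R]_n -> R :=
  fun t => pdF a b c (uncurryF F) (argu a b k alpha p1 q1 u t).

(* iterated integral  int_{a_1}^{b_1} ... int_{a_n}^{b_n} g dt_n ... dt_1
   (innermost integration in t_n) *)
Definition iint (R : realType) (n : nat) (a b : 'rV[R]_n) (g : 'rV[R]_n -> R) : R :=
  foldr (fun i (h : 'rV[R]_n -> R) =>
           fun t => \int[@lebesgue_measure R]_(s in `[a 0 i, b 0 i]) h (upd t i s))
        g (enum 'I_n) a.

Definition Jfun (R : realType) (n N : nat) (a b : 'rV[R]_n) (k : R -> R -> R)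
  (alpha p1 q1 : 'I_n -> R)
  (F : 'rV[R]_n -> 'rV[R]_N -> 'M[R]_(N, n) -> 'M[R]_(N, n) -> R)
  (u : 'rV[R]_n -> 'rV[R]_N) : R :=
  iint a b (Fu a b k alpha p1 q1 F u).

Definition admissible (R : realType) (n N : nat) (a b : 'rV[R]_n) (k : R -> R -> R)
  (alpha p1 q1 : 'I_n -> R) (psi : 'rV[R]_n -> 'rV[R]_N)
  (u : 'rV[R]_n -> 'rV[R]_N) : Prop :=
  (forall kk, C1_box a b (comp u kk)) /\
  (forall i kk, {within cbox a b,
       continuous (Bop a b k (alpha i) (p1 i) (q1 i) i (comp u kk))}) /\
  (forall t, cbox a b t -> ~ obox a b t -> u t = psi t).

(* Main.v *)
Require Import Defs.
From HB Require Import structures.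
From mathcomp Require Import all_boot all_order all_algebra.
From mathcomp Require Import all_classical all_reals all_analysis.
From mathcomp Require Import measurable_realfun ring lra.
Import Order.TTheory GRing.Theory Num.Theory numFieldNormedType.Exports.
Set Implicit Arguments. Unset Strict Implicit. Unset Printing Implicit Defensive.
Local Open Scope classical_set_scope.
Local Open Scope ring_scope.

(** Perturb the extremizer [u] in its [kk]-th component by [h * eta], where
    [eta] is a tensor product of one-dimensional C^1 bumps supported inside the
    box.  Only finitely many scalar arguments of [F] move, so changing them one
    at a time and applying the mean value theorem, together with compactness of
    the box, gives J[u + h eta] - J[u] = h * I + o(h), hence [I = 0], where [I]
    is the integral of F_x eta + sum_i (F_v B_i eta + F_w d_i eta).  Along each
    coordinate line [K] is convolution with the integrable kernel
    p k(x) 1_{x > 0} + q k(-x) 1_{x < 0}, and exchanging p and q reflects this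
    kernel; Fubini then moves [K] onto F_v as the dual operator, and integration
    by parts moves the derivatives off [eta].  As [eta] can be concentrated near
    any interior point, the remaining factor vanishes there. *)

(** * One-dimensional integrals *)
Section OneDim.
Context {R : realType}.
Notation mu := (@lebesgue_measure R).
Implicit Types (f g k : R -> R) (a b x t : R).

(** The kernels are merely integrable, so neither the continuity of [B i eta] nor the exchange of
    integrals can come from their regularity. The perturbed function is admissible only if [B i eta]
    is continuous. With [eta] a product, [B i eta] is a one-dimensional convolution times the other
    factors; the derivative of the bump vanishes off the interval, so the shift can be put on it
    instead of on the kernel. For Fubini, it is enough to dominate by a function of [x - y] with [x]
    in a bounded interval. A second difficulty is that the data are controlled on the closed box
    only, while all functions are total: precomposing with the projection onto the box turns
    continuity on the box into continuity everywhere. The iterated integral is never replaced by an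
    integral over a product space. Any coordinate can be brought to the innermost position, so an
    identity valid on every line in one direction integrates to the whole box. *)

Lemma continuous_integrable_itv f a b : continuous f ->
  mu.-integrable `[a, b] (EFin \o f).
Proof.
move=> cf; apply: continuous_compact_integrable; first exact: segment_compact.
exact: continuous_subspaceT.
Qed.

(** Lebesgue measure is determined by its values on half-open intervals, and a reflection maps these
    to half-open intervals of the same length. *)
Lemma lebesgue_measure_reflect t (A : set R) : measurable A ->
  pushforward mu ((fun x => t - x) : _ -> measurableTypeR R) A = mu A.
Proof.
move=> mA; apply/esym/lebesgue_measure_unique => //=; first exact: measurable_funB.
move=> mphi _ [[a b]] _ <-.
rewrite /pushforward/=.
have -> : (fun x : R => t - x) @^-1` `]a, b] = `[t - b, t - a[%classic.
  by apply/seteqP; split => x /=; rewrite !in_itv/= => /andP[? ?]; apply/andP; split; lra.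
rewrite !lebesgue_measure_itv/= !lte_fin ltrD2l ltrN2 -!EFinD.
by case: ifP => // _; congr EFin; ring.
Qed.

Lemma measurable_reflect t :
  measurable_fun setT ((fun x => t - x) : measurableTypeR R -> measurableTypeR R).
Proof. exact: measurable_funB. Qed.

Lemma integrable_reflect (f : R -> \bar R) t : mu.-integrable setT f ->
  mu.-integrable setT (fun x => f (t - x)).
Proof.
move=> /integrableP[mf if_]; apply/integrableP; split.
  by apply: (measurableT_comp mf); exact: measurable_reflect.
rewrite (_ : \int[mu]_x _ =
    \int[mu]_(x in ((fun x => t - x)%R : _ -> measurableTypeR R) @^-1` setT)
      ((abse \o f) \o (fun x => t - x)%R) x)%E; last first.
  by rewrite preimage_setT.
rewrite -ge0_integral_pushforward//=.
- rewrite (eq_measure_integral mu)//; first exact: measurable_reflect.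
  by move=> ? A mA _; exact: lebesgue_measure_reflect.
- exact: measurable_reflect.
- exact: measurableT_comp.
Qed.

Lemma integral_reflect (f : R -> \bar R) t : mu.-integrable setT f ->
  (\int[mu]_x f (t - x)%R = \int[mu]_x f x)%E.
Proof.
move=> if_; have mf := measurable_int _ if_.
rewrite (_ : \int[mu]_x f (t - x)%R =
    \int[mu]_(x in ((fun x => t - x)%R : _ -> measurableTypeR R) @^-1` setT)
      (f \o (fun x => t - x)%R) x)%E; last first.
  by rewrite preimage_setT.
rewrite -integral_pushforward//=.
- rewrite (eq_measure_integral mu)//; first exact: measurable_reflect.
  by move=> ? A mA _; exact: lebesgue_measure_reflect.
- exact: measurable_reflect.
- by rewrite preimage_setT; exact: integrable_reflect.
Qed.

(** The product sigma-algebra is generated by rectangles, so an open set is exhibited as the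
    countable union of the rational rectangles that it contains. *)
Lemma open_prod_measurable (U : set (R * R)) : open U ->
  measurable (U : set (measurableTypeR R * measurableTypeR R)%type).
Proof.
move=> oU.
(* Rectangles that leave [U] are replaced by [set0], so that the union can run over all quadruples
   of rationals. *)
pose V (q1 q2 q3 q4 : rat) : set (R * R) :=
  if `[< `]ratr q1 : R, ratr q2[ `*` `]ratr q3 : R, ratr q4[ `<=` U >]
  then `]ratr q1 : R, ratr q2[ `*` `]ratr q3 : R, ratr q4[ else set0.
have -> : U = \bigcup_q1 \bigcup_q2 \bigcup_q3 \bigcup_q4 V q1 q2 q3 q4.
  apply/seteqP; split => [[x y] Uxy|z [q1 _ [q2 _ [q3 _ [q4 _]]]]]; last first.
    by rewrite /V; case: asboolP => // h; exact: h.
  have /nbhs_ballP[e /= e0 eU] : nbhs (x, y) U by exact: open_nbhs_nbhs.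
  have near_rat (w : R) : exists q q' : rat, (w - e < ratr q < w) && (w < ratr q' < w + e).
    have [q] := rat_in_itvoo (ltac:(lra) : w - e < w).
    have [q'] := rat_in_itvoo (ltac:(lra) : w < w + e).
    by rewrite !in_itv/= => h' h; exists q, q'; rewrite h h'.
  have [q1 [q2 /andP[/andP[? ?] /andP[? ?]]]] := near_rat x.
  have [q3 [q4 /andP[/andP[? ?] /andP[? ?]]]] := near_rat y.
  exists q1 => //; exists q2 => //; exists q3 => //; exists q4 => //.
  rewrite /V; case: asboolP => [_|]; first by split; rewrite /= in_itv/=; apply/andP; split.
  case => -[x' y'] [/=]; rewrite !in_itv/= => /andP[? ?] /andP[? ?]; apply: eU.
  by split; rewrite /ball/= ltr_norml; apply/andP; split; lra.
do 4 (apply: bigcupT_measurable_rat => ?).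
rewrite /V; case: asboolP => // _; exact: measurableX.
Qed.
End OneDim.

(** * Exchange of the order of integration in the plane *)

Section Fubini.
Context {R : realType}.
Notation mu := (@lebesgue_measure R).
Implicit Types (f g k : R -> R) (a b x t : R).

Lemma continuous_prod_measurable (h : R * R -> R) : continuous h ->
  measurable_fun setT (h : measurableTypeR R * measurableTypeR R -> measurableTypeR R).
Proof.
move=> /continuousP ch; apply: (measurability _ (RGenOpens.measurableE R)).
move=> _ [_ [a [b ->] <-]]; rewrite setTI; apply: open_prod_measurable.
exact/ch/interval_open.
Qed.

Lemma Rintegral_indic (D : set R) f :
  \int[mu]_(x in D) f x = \int[mu]_x (\1_D x * f x).
Proof.
rewrite Rintegral_mkcond; apply: eq_Rintegral => x _; rewrite patchE indicE.
by case: ifP => _; rewrite ?mul1r ?mul0r.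
Qed.

(** By reflection the integral of [G (x - y)] over [y] does not depend on [x], so confining [x]
    alone to a bounded interval makes the majorant integrable on the plane. This form covers both
    continuous functions on a rectangle and products with an unbounded kernel. *)
Lemma RFubini_dominated (f : R -> R -> R) (G : R -> R) a b :
  measurable_fun setT (fun z : measurableTypeR R * measurableTypeR R => f z.1 z.2) ->
  mu.-integrable setT (EFin \o G) ->
  (forall x y, `|f x y| <= \1_`[a, b] x * G (x - y)) ->
  \int[mu]_x \int[mu]_y f x y = \int[mu]_y \int[mu]_x f x y.
Proof.
move=> mf iG fG.
have G0 x y : `|f x y| <= `|G (x - y)|.
  apply: le_trans (fG x y) _; rewrite indicE; case: (_ \in _); rewrite ?mul1r ?mul0r//.
  exact: ler_norm.
have iGx x : mu.-integrable setT (fun y => (G (x - y))%:E).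
  exact: (integrable_reflect x iG).
have iGy y : mu.-integrable setT (fun x => (G (x - y))%:E).
  have := integrable_reflect y (integrable_reflect 0 iG).
  by apply: eq_integrable => // x _ /=; congr (EFin (G _)); ring.
have ix x : mu.-integrable setT (EFin \o f x).
  apply: (le_integrable _ _ _ (iGx x)) => //.
    by apply/measurable_EFinP; exact: (measurable_fun_pair2 x mf).
  by move=> y _ /=; rewrite lee_fin.
have iy y : mu.-integrable setT (EFin \o f ^~ y).
  apply: (le_integrable _ _ _ (iGy y)) => //.
    by apply/measurable_EFinP; exact: (measurable_fun_pair1 y mf).
  by move=> x _ /=; rewrite lee_fin.
have ixy : (mu \x mu)%E.-integrable setT (fun z : R * R => (f z.1 z.2)%:E).
  apply/integrable12ltyP; first exact/measurable_EFinP.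
  (* Tonelli bounds the double integral by [C] times the length of [[a, b]]. *)
  pose C := (\int[mu]_y `|(G y)%:E|)%E.
  have Coo : (C < +oo)%E by case/integrableP : iG.
  have C0 : (0 <= C)%E by exact: integral_ge0.
  have CE : C = (fine C)%:E by rewrite fineK// ge0_fin_numE.
  apply: (@le_lt_trans _ _ (\int[mu]_(x in `[a, b]) C)%E); last first.
    rewrite -/C CE integral_cst//= lebesgue_measure_itv/=.
    by case: ifP => _; rewrite ?mule0 ?ltry// -EFinD -EFinM ltry.
  rewrite [leRHS]integral_mkcond; apply: ge0_le_integral => //=.
  - by move=> x _; exact: integral_ge0.
  - apply: (@measurable_fun_fubini_tonelli_F _ _ _ _ _ mu
    (fun z : R * R => `|(f z.1 z.2)%:E|%E)) => //=.
    by apply/measurable_EFinP; apply: measurableT_comp mf.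
  - by apply/(measurable_restrictT _ _).1.
  move=> x _; rewrite patchE; case: ifPn => [xab|xab].
    rewrite /C -(integral_reflect x (integrable_abse iG)).
    apply: ge0_le_integral => //=.
    + apply/measurable_EFinP; apply: measurableT_comp => //; apply/measurable_EFinP.
      exact: measurable_int (ix x).
    + apply/measurable_EFinP; apply: measurableT_comp => //; apply/measurable_EFinP.
      exact: measurable_int (iGx x).
    by move=> y _; rewrite lee_fin.
  rewrite integral0_eq// => y _; congr EFin; apply/eqP; rewrite -normr_le0 normr_id.
  by apply: le_trans (fG x y) _; rewrite indicE (negbTE xab) mul0r.
(* [fine] sends infinite values to 0; it can be removed from the inner integrals because every slice
   is integrable. *)
rewrite /Rintegral; congr fine.
transitivity (\int[mu]_x \int[mu]_y (f x y)%:E)%E.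
  by apply: eq_integral => x _; rewrite fineK//; exact: integrable_fin_num (ix x).
transitivity (\int[mu]_y \int[mu]_x (f x y)%:E)%E; last first.
  by apply: eq_integral => y _; rewrite fineK//; exact: integrable_fin_num (iy y).
exact: (Fubini ixy).
Qed.

Lemma RFubini_continuous (h : R * R -> R) a b c d : continuous h ->
  \int[mu]_(x in `[a, b]) \int[mu]_(y in `[c, d]) h (x, y) =
  \int[mu]_(y in `[c, d]) \int[mu]_(x in `[a, b]) h (x, y).
Proof.
move=> ch.
have cpt : compact (`[a, b] `*` `[c, d] : set (R * R)).
  by apply: compact_setX; exact: segment_compact.
have [M M0 hM] : exists2 M : R, 0 <= M & forall x y, `[a, b]%classic x ->
  `[c, d]%classic y -> `|h (x, y)| <= M.
  have := compact_bounded (continuous_compact (continuous_subspaceT ch) cpt).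
  case=> M [_ HM]; exists (`|M| + 1) => [|x y xab ycd]; first exact: addr_ge0.
  apply: HM; first by rewrite (le_lt_trans (ler_norm M))// ltrDl.
  by exists (x, y).
pose f x y := \1_`[a, b] x * (\1_`[c, d] y * h (x, y)).
transitivity (\int[mu]_x \int[mu]_y f x y).
  rewrite Rintegral_indic; apply: eq_Rintegral => x _.
  rewrite [in LHS]Rintegral_indic /f [\1_`[a, b] x]indicE; case: (_ \in _).
    by rewrite mul1r; apply: eq_Rintegral => y _; rewrite mul1r.
  rewrite mul0r; rewrite (@eq_Rintegral _ _ _ _ _ (cst 0)); last by move=> y _;
    rewrite mul0r.
  by rewrite Rintegral_cst// mul0r.
transitivity (\int[mu]_y \int[mu]_x f x y); last first.
  rewrite [RHS]Rintegral_indic; apply: eq_Rintegral => y _.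
  rewrite [in RHS]Rintegral_indic /f [\1_`[c, d] y]indicE; case: (_ \in _).
    by rewrite mul1r; apply: eq_Rintegral => x _; rewrite mul1r.
  rewrite mul0r; rewrite (@eq_Rintegral _ _ _ _ _ (cst 0)); last by move=> x _;
    rewrite mul0r mulr0.
  by rewrite Rintegral_cst// mul0r.
(* For [x] in [[a, b]] and [y] in [[c, d]], the difference [x - y] lies in [[a - d, b - c]]. *)
apply: (@RFubini_dominated _ (fun z => M * \1_`[a - d, b - c] z) a b).
- apply: measurable_funM.
    by apply: measurableT_comp => //; exact: measurable_fst.
  apply: measurable_funM.
    by apply: measurableT_comp => //; exact: measurable_snd.
  rewrite (_ : (fun z : R * R => h (z.1, z.2)) = h); last by apply/funext => -[].
  exact: continuous_prod_measurable.
- rewrite (_ : _ \o _ = (fun x => M%:E * (\1_`[(a - d), (b - c)] x)%:E)%E)//.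
  by apply: integrableZl => //; exact: integrable_indic_itv.
move=> x y; rewrite /f !indicE.
case: (boolP (x \in _)) => [/set_mem xab|_]; last by rewrite !mul0r normr0.
case: (boolP (y \in _)) => [/set_mem ycd|_]; last first.
  by rewrite !mul0r mulr0 normr0 mul1r mulr_ge0.
rewrite mem_set ?mulr1 ?mul1r; first exact: hM.
move: xab ycd => /=; rewrite !in_itv/= => /andP[? ?] /andP[? ?]; apply/andP; split; lra.
Qed.
End Fubini.

(** * The kernel operator on a line *)
Section Kernel.
Context {R : realType}.
Notation mu := (@lebesgue_measure R).
Implicit Types (f g k kp : R -> R) (a b x t p q L : R).

(* Written with [0 - x] rather than [- x] so that [integrable_reflect] applies. *)
Definition kernel2 L k p q : R -> R := fun x =>
  p * (k \_ `]0, L[) x + q * (k \_ `]0, L[) (0 - x).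

Lemma kernel2C L k p q x : kernel2 L k q p x = kernel2 L k p q (0 - x).
Proof. by rewrite /kernel2 subKr addrC. Qed.

Lemma integrable_restr0 L k : mu.-integrable `]0, L[ (EFin \o k) ->
  mu.-integrable setT (EFin \o (k \_ `]0, L[)).
Proof. by move=> ik; rewrite -restrict_EFin; apply/(integrable_mkcond _ _).1. Qed.

Lemma kernel2_integrable L k p q : mu.-integrable `]0, L[ (EFin \o k) ->
  mu.-integrable setT (EFin \o kernel2 L k p q).
Proof.
move=> /integrable_restr0 ik.
rewrite (_ : _ \o _ = (fun x => p%:E * (EFin \o (k \_ `]0%R, L[)) x)
   \+ (fun x => q%:E * (EFin \o (k \_ `]0%R, L[)) (0 - x)%R))%E; last first.
  by apply/funext => x /=; rewrite /kernel2 EFinD !EFinM.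
by apply: integrableD => //; apply: integrableZl => //; exact: (integrable_reflect 0 ik).
Qed.

Lemma continuous_itv_bounded g a b : continuous g ->
  exists2 M : R, 0 <= M & forall x, x \in `[a, b] -> `|g x| <= M.
Proof.
move=> cg.
have := compact_bounded (continuous_compact (continuous_subspaceT cg)
  (@segment_compact _ a b)).
case=> M [_ HM]; exists (`|M| + 1) => [|x xab]; first exact: addr_ge0.
by apply: HM; [rewrite (le_lt_trans (ler_norm M))// ltrDl|exists x].
Qed.

Lemma conv_integrable kp g a b x : mu.-integrable setT (EFin \o kp) ->
  continuous g -> mu.-integrable `[a, b] (fun y => (kp (x - y) * g y)%:E).
Proof.
move=> ikp cg.
have i1 : mu.-integrable `[a, b] (fun y => (kp (x - y))%:E).
  apply: (integrableS measurableT) => //; exact: (integrable_reflect x ikp).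
rewrite (_ : (fun y => _) = ((fun y => (kp (x - y)%R)%:E) \* (EFin \o g)))%E; last first.
  by apply/funext => y; rewrite EFinM.
apply: integrableMl => //.
  by apply: measurable_funTS; exact: continuous_measurable_fun.
have := compact_bounded (continuous_compact (continuous_subspaceT cg)
  (@segment_compact _ a b)).
case=> M [Mr HM]; exists M; split => // N MN y yab; apply: (HM N MN); by exists y.
Qed.

(** For [y] in []a, x[] the difference [x - y] lies in []0, L[], and beyond [x] the truncated kernel
    is 0, so the first integral may run over all of [[a, b]]; the second is symmetric. *)
Lemma kernel2E L k p q g a b x : L = b - a -> x \in `[a, b] ->
  mu.-integrable `]0, L[ (EFin \o k) -> continuous g ->
  p * \int[mu]_(y in `[a, x]) (k (x - y) * g y)
  + q * \int[mu]_(y in `[x, b]) (k (y - x) * g y)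
  = \int[mu]_(y in `[a, b]) (kernel2 L k p q (x - y) * g y).
Proof.
move=> EL; rewrite in_itv/= => /andP[ax xb] ik cg.
pose K := k \_ `]0, L[.
have iK := integrable_restr0 ik.
have iKo : mu.-integrable setT (EFin \o (fun y => K (0 - y))).
  exact: (integrable_reflect 0 iK).
have i1 c d := @conv_integrable K g c d x iK cg.
have i2 c d := @conv_integrable _ g c d x iKo cg.
transitivity (\int[mu]_(y in `[a, b]) (p * (K (x - y) * g y) + q * (K (0 -
  (x - y)) * g y))); last first.
  by apply: eq_Rintegral => y _; rewrite /kernel2 -/K; ring.
have i1' : mu.-integrable `[a, b] (EFin \o (fun y => p * (K (x - y) * g y))).
  rewrite (_ : _ \o _ = (fun y => p%:E * (K (x - y)%R * g y)%:E)%E)//.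
  by apply: integrableZl => //; exact: i1.
have i2' : mu.-integrable `[a, b] (EFin \o (fun y => q * (K (0 - (x - y)) * g y))).
  rewrite (_ : _ \o _ = (fun y => q%:E * (K (0 - (x - y))%R * g y)%:E)%E)//.
  by apply: integrableZl => //; exact: i2.
rewrite RintegralD// RintegralZl//.
rewrite RintegralZl//.
have oo c d (h : R -> R) : mu.-integrable `[c, d] (EFin \o h) ->
    mu.-integrable `]c, d[ (EFin \o h).
  by apply: integrableS => //; exact: subset_itv_oo_cc.
(* Passing to open intervals discards the end points, where [k] and its truncation may differ. *)
have cco c d (h : R -> R) : mu.-integrable `]c, d[ (EFin \o h) ->
    \int[mu]_(y in `[c, d]) h y = \int[mu]_(y in `]c, d[) h y.
  by move=> ih; rewrite /Rintegral integral_itv_bndoo//; exact: (measurable_int mu).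
congr (_ * _ + _ * _).
- have E1 : {in (`]a, x[%classic : set R), (fun y => K (x - y) * g y) =1 (fun y => k
  (x - y) * g y)}.
    move=> y /set_mem/=; rewrite in_itv/= => /andP[ay yx].
    rewrite /K patchE mem_set//= in_itv/=; apply/andP; split; lra.
  rewrite cco; last first.
    apply: eq_integrable (oo _ _ _ (i1 a x)) => // y yax.
    by rewrite /= -(E1 y).
  transitivity (\int[mu]_(y in `]a, x[) (K (x - y) * g y)).
    by apply: eq_Rintegral => y yax; rewrite -(E1 y).
  rewrite -cco; last exact: oo.
  rewrite Rintegral_mkcond [RHS]Rintegral_mkcond; apply: eq_Rintegral => y _.
  rewrite !patchE; case: ifPn => [/set_mem/=|]; rewrite ?notin_setE/= !in_itv/=.
    by move=> /andP[ay yx]; rewrite mem_set//= in_itv/= ay (le_trans yx).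
  move=> yx; case: ifPn => // /set_mem/=; rewrite in_itv/= => /andP[ay yb].
  rewrite /K patchE memNset ?mul0r//= in_itv/= => /andP[xy _]; apply: yx.
  rewrite ay; lra.
- have E1 : {in (`]x, b[%classic : set R), (fun y => K (0 - (x - y)) * g y) =1
  (fun y => k (y - x) * g y)}.
    move=> y /set_mem/=; rewrite in_itv/= => /andP[ay yx].
    rewrite sub0r opprB /K patchE mem_set//= in_itv/=; apply/andP; split; lra.
  rewrite cco; last first.
    apply: eq_integrable (oo _ _ _ (i2 x b)) => // y yax.
    by rewrite /= -(E1 y).
  transitivity (\int[mu]_(y in `]x, b[) (K (0 - (x - y)) * g y)).
    by apply: eq_Rintegral => y yax; rewrite -(E1 y).
  rewrite -cco; last exact: oo.
  rewrite Rintegral_mkcond [RHS]Rintegral_mkcond; apply: eq_Rintegral => y _.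
  rewrite !patchE; case: ifPn => [/set_mem/=|]; rewrite ?notin_setE/= !in_itv/=.
    by move=> /andP[ay yx]; rewrite mem_set//= in_itv/= yx (le_trans ax).
  move=> yx; case: ifPn => // /set_mem/=; rewrite in_itv/= => /andP[ay yb].
  rewrite /K patchE memNset ?mul0r//= in_itv/= => /andP[xy _]; apply: yx.
  rewrite yb andbT; lra.
Qed.

Lemma conv_dual kp f g a b : mu.-integrable setT (EFin \o kp) ->
  continuous f -> continuous g ->
  \int[mu]_(x in `[a, b]) (f x * \int[mu]_(y in `[a, b]) (kp (x - y) * g y)) =
  \int[mu]_(y in `[a, b]) (\int[mu]_(x in `[a, b]) (kp (x - y) * f x) * g y).
Proof.
move=> ikp cf cg.
have bnd (h : R -> R) : continuous h ->
  exists2 M : R, 0 <= M & forall x, \1_`[a, b] x * `|h x| <= M.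
  move=> /(@continuous_itv_bounded _ a b)[M M0 HM]; exists M => // x.
  rewrite indicE; case: (boolP (x \in _)) => [/set_mem xab|_]; rewrite ?mul0r//.
  by rewrite mul1r HM.
have [Mf Mf0 HMf] := bnd _ cf; have [Mg Mg0 HMg] := bnd _ cg.
(* The cut-offs turn both sides into integrals over the whole line, and the bounds of [f] and [g] on
   [[a, b]] leave a multiple of [|kp|] as majorant. *)
pose F x y := (\1_`[a, b] x * f x) * kp (x - y) * (\1_`[a, b] y * g y).
transitivity (\int[mu]_x \int[mu]_y F x y).
  rewrite Rintegral_indic; apply: eq_Rintegral => x _.
  rewrite mulrA -RintegralZl//; last exact: conv_integrable.
  rewrite Rintegral_indic; apply: eq_Rintegral => y _; rewrite /F; ring.
transitivity (\int[mu]_y \int[mu]_x F x y); last first.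
  rewrite [RHS]Rintegral_indic; apply: eq_Rintegral => y _.
  rewrite mulrCA -[RHS]RintegralZr//; last first.
    have ikp' : mu.-integrable setT (EFin \o (fun x => kp (0 - x))) by exact:
      (integrable_reflect 0 ikp).
    apply: eq_integrable (@conv_integrable _ f a b y ikp' cf) => // x _ /=.
    by congr (EFin (kp _ * _)); ring.
  rewrite [in RHS]Rintegral_indic; apply: eq_Rintegral => x _; rewrite /F; ring.
apply: (@RFubini_dominated _ _ (fun z => Mf * Mg * `|kp z|) a b).
- have mi (h : R -> R) : continuous h ->
  measurable_fun setT (fun x => \1_`[a, b] x * h x : R).
    by move=> ch; apply: measurable_funM => //; exact: continuous_measurable_fun.
  apply: measurable_funM; last first.
    by apply: (measurableT_comp (mi _ cg)); exact: measurable_snd.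
  apply: measurable_funM.
    by apply: (measurableT_comp (mi _ cf)); exact: measurable_fst.
  have mkp : measurable_fun setT kp by apply/measurable_EFinP; exact: (measurable_int mu).
  apply: (measurableT_comp mkp); apply: measurable_funB;
    [exact: measurable_fst|exact: measurable_snd].
- rewrite (_ : _ \o _ = (fun x => (Mf * Mg)%:E * `|(EFin \o kp) x|)%E)//.
  by apply: integrableZl => //; exact: integrable_abse.
move=> x y; rewrite /F !normrM.
have -> : `|\1_`[a, b] x| = \1_`[a, b] x :> R by rewrite ger0_norm// indicE.
have -> : `|\1_`[a, b] y| = \1_`[a, b] y :> R by rewrite ger0_norm// indicE.
rewrite (_ : \1_`[a, b] x * (Mf * Mg * `|kp (x - y)|) =
  (\1_`[a, b] x * Mf) * `|kp (x - y)| * Mg); last by ring.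
apply: ler_pM => //; rewrite ?mulr_ge0// ?indicE//.
apply: ler_wpM2r => //; have := HMf x; rewrite indicE; case: (_ \in _);
  by rewrite ?mul1r ?mul0r.
Qed.

(** [kp] has no continuity to offer. Since [g] vanishes off [[a, b]], the integral extends to the
    whole line, and substituting [x - y] for [y] shifts [g] instead of [kp]; dominated convergence
    with majorant [|kp| * M] then applies. *)
Lemma conv_continuous kp g a b : mu.-integrable setT (EFin \o kp) ->
  continuous g -> (forall y, y \notin `[a, b] -> g y = 0) ->
  continuous (fun x => \int[mu]_(y in `[a, b]) (kp (x - y) * g y)).
Proof.
move=> ikp cg g0.
have [M HM] : exists M : R, forall x, `|g x| <= M.
  have [M M0 HM] := @continuous_itv_bounded _ a b cg; exists M => x.
  by case: (boolP (x \in `[a, b])) => xab; [exact: HM|rewrite g0// normr0].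
have ix x : mu.-integrable setT (EFin \o (fun y => kp y * g (x - y))).
  rewrite (_ : _ \o _ = ((fun y => (kp y)%:E) \* (EFin \o (fun y => g (x - y)%R))))%E;
    last first.
    by apply/funext => y; rewrite /= EFinM.
  apply: integrableMl => //.
    apply: continuous_measurable_fun => y.
    by apply: continuous_comp; [apply: cvgB; [exact: cvg_cst|exact: cvg_id]|exact: cg].
  by exists M; split => [|N MN y _]; [exact: num_real|exact: le_trans (HM _) (ltW MN)].
rewrite (_ : (fun x => _) = (fun x => \int[mu]_y (kp y * g (x - y)))); last first.
  apply/funext => x; rewrite /Rintegral -[in RHS](integral_reflect x (ix x)).
  rewrite [in LHS]integral_mkcond; congr fine; apply: eq_integral => y _ /=.
  rewrite patchE subKr; case: ifPn => // yab; rewrite g0 ?mulr0//.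
  by apply: contra yab => yab; rewrite inE.
move=> x; apply: (@continuity_under_integral _ _ _ mu (fun x y => kp y * g
  (x - y)) setT measurableT (x - 1) (x + 1)
  _ _ (fun y => `|kp y| * M)) => //.
- apply: aeW => y _ z _; apply: cvgM; first exact: cvg_cst.
  by apply: continuous_comp; [apply: cvgB; [exact: cvg_id|exact: cvg_cst]|exact: cg].
- rewrite (_ : _ \o _ = (fun x => `|(EFin \o kp) x| * M%:E)%E)//.
  by apply: integrableZr => //; exact: integrable_abse.
- by move=> z _; apply: aeW => y _; rewrite normrM ler_wpM2l.
by rewrite inE/= in_itv/=; apply/andP; split; lra.
Qed.
End Kernel.

(** * Boxes and iterated integrals *)
Lemma cvg_mx_coord {R : realType} {T : Type} (F : set_system T) {FF : Filter F}
  (m n : nat) (f : T -> 'M[R]_(m, n)) (M : 'M[R]_(m, n)) :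
  (forall i j, f x i j @[x --> F] --> M i j) -> f x @[x --> F] --> M.
Proof.
move=> h A [P MP sPA].
have : \forall x \near F, forall i j, P i j (f x i j).
  by apply: filter_forall => i; apply: filter_forall => j; exact: h.
by apply: filterS => x Px; exact: sPA.
Qed.

Lemma continuous_mx {R : realType} {T : topologicalType} (m n : nat)
  (f : T -> 'M[R]_(m, n)) : (forall i j, continuous (fun x => f x i j)) -> continuous f.
Proof.
by move=> cf x; apply: (@cvg_mx_coord _ _ (nbhs x)) => i j; exact: cf.
Qed.

Lemma continuous_comp_within {S T U : topologicalType} (D : set T) (g : T -> U)
  (f : S -> T) : {within D, continuous g} -> continuous f -> (forall x, D (f x)) ->
  continuous (g \o f).
Proof.
move=> /subspace_continuousP cg cf Df x A Agfx.
have gA : nbhs (f x) (fun y => D y -> A (g y)) := cg _ (Df x) _ Agfx.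
have : nbhs x (fun y => D (f y) -> A (g (f y))) := cf x _ gA.
by apply: filterS => y; apply; exact: Df.
Qed.

Section Box.
Context {R : realType} {n : nat} (a b : 'rV[R]_n).
Hypothesis ab : forall i, a 0 i < b 0 i.
Notation mu := (@lebesgue_measure R).

(** The coordinatewise nearest-point projection onto the box. Composition with it extends a function
    continuous on the box to one continuous everywhere, with the same values on the box. *)
Definition clamp (t : 'rV[R]_n) : 'rV[R]_n :=
  \row_j Num.max (a 0 j) (Num.min (b 0 j) (t 0 j)).

Lemma clamp_cbox t : cbox a b (clamp t).
Proof.
move=> i; rewrite mxE le_max lexx/= ge_max (ltW (ab i))/=.
by rewrite ge_min lexx.
Qed.

Lemma clamp_id t : cbox a b t -> clamp t = t.
Proof.
move=> tab; apply/rowP => i; rewrite mxE; have /andP[at_ tb] := tab i.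
by rewrite min_r// max_r.
Qed.

Lemma cbox_lower : cbox a b a.
Proof. by move=> i; rewrite lexx (ltW (ab i)). Qed.

Lemma obox_cbox t : obox a b t -> cbox a b t.
Proof. by move=> tab i; have /andP[? ?] := tab i; rewrite !ltW. Qed.

Lemma clamp_continuous : continuous clamp.
Proof.
apply: (@continuous_mx R) => i j; under eq_fun do rewrite mxE.
move=> t.
apply: (@continuous_max R _ (fun=> a 0 j) (fun t : 'rV[R]_n => Num.min (b 0 j) (t 0 j)));
  first exact: cst_continuous.
apply: (@continuous_min R _ (fun=> b 0 j) (fun t : 'rV[R]_n => t 0 j));
  first exact: cst_continuous.
exact: coord_continuous.
Qed.

Lemma clamp_continuousP (U : topologicalType) (f : 'rV[R]_n -> U) :
  {within cbox a b, continuous f} <-> continuous (f \o clamp).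
Proof.
split=> [cf|cf].
  exact: continuous_comp_within cf clamp_continuous clamp_cbox.
apply: (@subspace_eq_continuous _ _ _ (f \o clamp)); last exact: continuous_subspaceT.
by move=> t /set_mem tab; rewrite /= clamp_id.
Qed.

Lemma upd_id (t : 'rV[R]_n) i : upd t i (t 0 i) = t.
Proof. by apply/rowP => j; rewrite mxE; case: eqP => // ->. Qed.

Lemma upd_upd (t : 'rV[R]_n) i x y : upd (upd t i x) i y = upd t i y.
Proof. by apply/rowP => j; rewrite !mxE; case: eqP. Qed.

Lemma updC (t : 'rV[R]_n) i j x y : i != j ->
  upd (upd t i x) j y = upd (upd t j y) i x.
Proof.
move=> ij; apply/rowP => l; rewrite !mxE; case: eqP => // ->.
by rewrite eq_sym (negbTE ij).
Qed.

Lemma updE (t : 'rV[R]_n) i x : upd t i x 0 i = x.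
Proof. by rewrite mxE eqxx. Qed.

Lemma upd_cbox t i x : cbox a b t -> x \in `[a 0 i, b 0 i] -> cbox a b (upd t i x).
Proof. by move=> tab; rewrite in_itv/= => xab j; rewrite mxE; case: eqP => [->|_]. Qed.

Lemma clamp_upd t i x : x \in `[a 0 i, b 0 i] -> clamp (upd t i x) = upd (clamp t) i x.
Proof.
rewrite in_itv/= => /andP[ax xb]; apply/rowP => j; rewrite !mxE.
by case: eqP => // ->; rewrite min_r// max_r.
Qed.

Lemma upd_continuous i : continuous (fun z : R * 'rV[R]_n => upd z.2 i z.1).
Proof.
apply: (@continuous_mx R) => k j; under eq_fun do rewrite mxE.
move=> z.
case: eqP => _; first exact: cvg_fst.
by apply: (@continuous_comp _ _ _ snd (fun v : 'rV[R]_n => v 0 j));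
  [exact: cvg_snd|exact: coord_continuous].
Qed.

Lemma upd_continuousr (t : 'rV[R]_n) i : continuous (fun x => upd t i x).
Proof.
apply: (@continuous_mx R) => k j; under eq_fun do rewrite mxE.
move=> x.
by case: eqP => _; [exact: cvg_id|exact: cvg_cst].
Qed.

Lemma line_continuous (g : 'rV[R]_n -> R) t i : continuous g ->
  continuous (fun x => g (upd t i x)).
Proof. by move=> cg x; apply: continuous_comp; [exact: upd_continuousr|exact: cg]. Qed.

Lemma line_continuous_within (g : 'rV[R]_n -> R) t i : {within cbox a b, continuous g} ->
  cbox a b t -> {within `[a 0 i, b 0 i], continuous (fun x => g (upd t i x))}.
Proof.
move=> /clamp_continuousP cg tab.
apply: (@subspace_eq_continuous _ _ _ (fun x => (g \o clamp) (upd t i x))).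
  by move=> x /set_mem xab; rewrite /= clamp_upd// clamp_id.
by apply: continuous_subspaceT; exact: line_continuous.
Qed.

Lemma Rintegral_dist (f g : R -> R) (c d e : R) : c < d ->
  continuous f -> continuous g ->
  (forall x, x \in `[c, d] -> `|f x - g x| <= e) ->
  `|\int[mu]_(x in `[c, d]) f x - \int[mu]_(x in `[c, d]) g x| <= e * (d - c).
Proof.
move=> cd cf cg fg.
have cfg : continuous (fun x => f x - g x) by move=> x; apply: cvgB; [exact: cf|exact: cg].
rewrite -RintegralB//; [|exact: continuous_integrable_itv..].
apply: le_trans (le_normr_Rintegral _ _) _ => //; first exact: continuous_integrable_itv.
have -> : e * (d - c) = \int[mu]_(x in `[c, d]) e.
  by rewrite Rintegral_cst//= lebesgue_measure_itv/= lte_fin cd.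
apply: le_Rintegral => //.
- apply: continuous_integrable_itv => x; apply: cvg_norm; exact: cfg.
- by apply: continuous_integrable_itv => x; exact: cvg_cst.
Qed.

(** Near [x0] the function stays above [f x0 / 2], on a subinterval of [[c, d]] of positive length
    even if [x0] is an end point; nonnegativity disposes of the rest. *)
Lemma Rintegral_itv_gt0 (f : R -> R) (c d x0 : R) : c < d -> continuous f ->
  (forall x, x \in `[c, d] -> 0 <= f x) -> x0 \in `[c, d] -> 0 < f x0 ->
  0 < \int[mu]_(x in `[c, d]) f x.
Proof.
move=> cd cf f0 x0cd fx0.
have [e /= e0 He] : exists2 e : R, 0 < e & forall x, `|x0 - x| < e -> f x0 / 2 < f x.
  have /cvgrPdist_lt/(_ (f x0 / 2)) := cf x0.
  rewrite divr_gt0// => /(_ isT)/nbhs_ballP[e /= e0 He]; exists e => // x xe.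
  by have := He x xe; rewrite /= ltr_distlC => /andP[]; lra.
move: x0cd; rewrite in_itv/= => /andP[cx xd].
pose l := Num.max c (x0 - e / 2); pose r := Num.min d (x0 + e / 2).
have cl : c <= l by rewrite le_max lexx.
have rd : r <= d by rewrite ge_min lexx.
have lr : l < r by rewrite lt_min !gt_max; apply/andP; split; apply/andP; split; lra.
have ll : x0 - e / 2 <= l by rewrite le_max lexx orbT.
have rr : r <= x0 + e / 2 by rewrite ge_min lexx orbT.
apply: (@lt_le_trans _ _ (\int[mu]_(x in `[l, r]) (f x0 / 2))).
  rewrite Rintegral_cst//= lebesgue_measure_itv/= lte_fin lr/= !mulr_gt0//; lra.
apply: (@le_trans _ _ (\int[mu]_(x in `[l, r]) f x)).
  apply: le_Rintegral => //.
  - by apply: continuous_integrable_itv => x; exact: cvg_cst.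
  - exact: continuous_integrable_itv.
  - move=> x /=; rewrite in_itv/= => /andP[? ?]; apply/ltW/He.
    by rewrite ltr_norml; apply/andP; split; lra.
rewrite Rintegral_mkcond [leRHS]Rintegral_mkcond.
have i1 (u v : R) : mu.-integrable setT (EFin \o (f \_ `[u, v])).
  by rewrite -restrict_EFin; apply/(integrable_mkcond _ _).1 => //;
    exact: continuous_integrable_itv.
apply: le_Rintegral => // x _; rewrite !patchE.
case: ifPn => [/set_mem|_]; last first.
  by case: ifPn => // /set_mem/= xcd; exact: f0.
rewrite /= in_itv/= => /andP[lx xr]; rewrite mem_set//= in_itv/=.
by rewrite (le_trans cl lx) (le_trans xr rd).
Qed.
End Box.

(** * Iterated integrals, one coordinate at a time *)

Section IteratedIntegral.
Context {R : realType} {n : nat} (a b : 'rV[R]_n).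
Hypothesis ab : forall i, a 0 i < b 0 i.
Notation mu := (@lebesgue_measure R).
Implicit Types (f g h : 'rV[R]_n -> R) (s : seq 'I_n).

Definition lint (i : 'I_n) h (t : 'rV[R]_n) : R :=
  \int[mu]_(x in `[a 0 i, b 0 i]) h (upd t i x).

(** The segment of integration is compact, so for [t] near [t0] the integrands on the two parallel
    segments are close at all points simultaneously. *)
Lemma lint_continuous i h : continuous h -> continuous (lint i h).
Proof.
move=> ch t0; apply/(@cvgrPdist_le R R _ (nbhs t0)) => e e0.
have L0 : 0 < b 0 i - a 0 i by rewrite subr_gt0.
have cpt : compact (`[a 0 i, b 0 i] : set R) by exact: segment_compact.
have unif : \forall t \near t0, `[a 0 i, b 0 i] `<=`
    [set x | `|h (upd t0 i x) - h (upd t i x)| < e / (b 0 i - a 0 i)].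
  apply: ((compact_near_coveringP _).1 cpt _ (nbhs t0)
    (fun t x => `|h (upd t0 i x) - h (upd t i x)| < e / (b 0 i - a 0 i))) => x xab.
  have cH : continuous (fun z : R * 'rV[R]_n => h (upd t0 i z.1) - h (upd z.2 i z.1)).
    move=> z; apply: cvgB.
      apply: (@continuous_comp _ _ _ fst (fun x => h (upd t0 i x))); first exact: cvg_fst.
      exact: line_continuous.
    by apply: (@continuous_comp _ _ _ (fun z : R * 'rV[R]_n => upd z.2 i z.1));
      [exact: upd_continuous|exact: ch].
  have /cvgr0Pnorm_lt/(_ (e / (b 0 i - a 0 i))) : (fun z : R * 'rV[R]_n => h
    (upd t0 i z.1) - h (upd z.2 i z.1)) @ nbhs (x, t0) --> (0 : R).
    by have := cH (x, t0); rewrite /continuous_at/= subrr.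
  by rewrite divr_gt0// => /(_ isT).
near=> t.
have -> : e = e / (b 0 i - a 0 i) * (b 0 i - a 0 i) by rewrite divfK// gt_eqF.
apply: Rintegral_dist => //; [exact: line_continuous..|].
move=> x xab; apply/ltW; move: x xab; near: t; exact: unif.
Unshelve. all: by end_near. Qed.

Lemma lintC i j g : continuous g -> lint i (lint j g) = lint j (lint i g).
Proof.
move=> cg; have [->//|ij] := eqVneq i j.
apply/funext => t; rewrite /lint.
transitivity (\int[mu]_(y in `[a 0 j, b 0 j]) \int[mu]_(x in `[a 0 i, b 0 i]) g (upd
  (upd t i x) j y)).
  apply: (@RFubini_continuous _ (fun z => g (upd (upd t i z.1) j z.2))) => z.
  apply: (@continuous_comp _ _ _ (fun z => upd (upd t i z.1) j z.2) g); last exact: cg.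
  move: z; apply: (@continuous_mx R) => k l; under eq_fun do rewrite !mxE.
  move=> z; case: eqP => _; first exact: cvg_snd.
  by case: eqP => _; [exact: cvg_fst|exact: cst_continuous].
by apply: eq_Rintegral => y _; apply: eq_Rintegral => x _; rewrite updC.
Qed.

(** [iint] is the case of the list [enum 'I_n] at the base point [a]; arbitrary lists and points are
    what induction needs. *)
Definition mint s g := foldr lint g s.

Lemma mint_continuous s g : continuous g -> continuous (mint s g).
Proof. by move=> cg; elim: s => //= i s IH; exact: lint_continuous. Qed.

Lemma mint_lint s i g : continuous g -> mint s (lint i g) = lint i (mint s g).
Proof. by move=> cg; elim: s => //= j s ->; rewrite lintC//; exact: mint_continuous. Qed.

Lemma mint_lin s f g c t : continuous f -> continuous g ->
  mint s (fun t => f t + c * g t) t = mint s f t + c * mint s g t.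
Proof.
move=> cf cg; elim: s t => //= i s IH t; rewrite /lint.
under eq_Rintegral do rewrite IH.
have cl h : continuous h -> continuous (fun x => mint s h (upd t i x)).
  by move=> ch; apply: line_continuous; exact: mint_continuous.
rewrite RintegralD//.
- by rewrite RintegralZl//; apply: continuous_integrable_itv; exact: cl.
- by apply: continuous_integrable_itv; exact: cl.
- apply: (@continuous_integrable_itv _ (fun x => c * mint s g (upd t i x))).
  by move=> x; apply: cvgM; [exact: cvg_cst|exact: cl].
Qed.

Lemma mint_le s f g t : continuous f -> continuous g -> (forall t, f t <= g t) ->
  mint s f t <= mint s g t.
Proof.
move=> cf cg fg; elim: s t => //= i s IH t; apply: le_Rintegral => //.
- by apply: continuous_integrable_itv; apply: line_continuous; exact: mint_continuous.
- by apply: continuous_integrable_itv; apply: line_continuous; exact: mint_continuous.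
Qed.

Lemma mint_ge0 s g t : (forall t, 0 <= g t) -> 0 <= mint s g t.
Proof. by move=> g0; elim: s t => //= i s IH t; exact: Rintegral_ge0. Qed.

(** Positivity is carried outwards at the fixed point [t]: the partial integral, as a function of
    the next coordinate, is nonnegative, continuous, and positive at the value [t 0 i]. *)
Lemma mint_gt0 s g t : continuous g -> (forall t, 0 <= g t) -> cbox a b t ->
  0 < g t -> 0 < mint s g t.
Proof.
move=> cg g0 tab gt; elim: s => //= i s IH.
apply: (@Rintegral_itv_gt0 _ _ _ _ (t 0 i)) => //.
- by apply: line_continuous; exact: mint_continuous.
- by move=> x _; exact: mint_ge0.
- by rewrite in_itv/=; exact: tab.
- by rewrite upd_id.
Qed.

(** Coordinates in [s] are overwritten before [g] is evaluated. For the full list this frees [iint]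
    from its base point. *)
Lemma mint_indep s g (t t' : 'rV[R]_n) : (forall j, j \notin s -> t 0 j = t' 0 j) ->
  mint s g t = mint s g t'.
Proof.
elim: s t t' => [|i s IH] t t' tt' /=.
  by congr g; apply/rowP => j; rewrite tt'.
apply: eq_Rintegral => x _; apply: IH => j js; rewrite !mxE.
by case: eqP => // /eqP ji; apply: tt'; rewrite inE negb_or ji.
Qed.

Lemma mint_eq_cbox s f g t : (forall t, cbox a b t -> f t = g t) -> cbox a b t ->
  mint s f t = mint s g t.
Proof.
move=> fg; elim: s t => [|i s IH] t tab /=; first exact: fg.
by apply: eq_Rintegral => x /set_mem/= xab; apply: IH; exact: upd_cbox.
Qed.

Notation bcont f := {within cbox a b, continuous f}.

Lemma iint_clamp f : iint a b f = mint (enum 'I_n) (f \o clamp a b) a.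
Proof.
apply: mint_eq_cbox; last exact: cbox_lower.
by move=> t tab; rewrite /= clamp_id.
Qed.

Lemma eq_iint f g : (forall t, cbox a b t -> f t = g t) -> iint a b f = iint a b g.
Proof. by move=> fg; apply: mint_eq_cbox => //; exact: cbox_lower. Qed.

Lemma iint_lin f g c : bcont f -> bcont g ->
  iint a b (fun t => f t + c * g t) = iint a b f + c * iint a b g.
Proof.
by move=> /(clamp_continuousP ab) cf /(clamp_continuousP ab) cg;
  rewrite !iint_clamp mint_lin//.
Qed.

Lemma iint_le f g : bcont f -> bcont g -> (forall t, cbox a b t -> f t <= g t) ->
  iint a b f <= iint a b g.
Proof.
move=> /(clamp_continuousP ab) cf /(clamp_continuousP ab) cg fg;
  rewrite !iint_clamp mint_le//.
by move=> t; apply: fg; exact: clamp_cbox.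
Qed.

Lemma iint_gt0 f t : bcont f -> (forall t, cbox a b t -> 0 <= f t) -> cbox a b t ->
  0 < f t -> 0 < iint a b f.
Proof.
move=> /(clamp_continuousP ab) cf f0 tab ft.
rewrite iint_clamp (@mint_indep _ _ _ t); last by move=> j; rewrite mem_enum.
apply: mint_gt0 => //.
- by move=> t'; apply: f0; exact: clamp_cbox.
- by rewrite /= clamp_id.
Qed.

(** Integrals in different coordinates commute, so the [i]-th can be made innermost, where it gives
    0. This is the passage from lines to the box. *)
Lemma iint_line0 f i : bcont f -> (forall t, cbox a b t -> lint i f t = 0) ->
  iint a b f = 0.
Proof.
move=> /(clamp_continuousP ab) cf fi; rewrite iint_clamp.
have zero s t : mint s (fun=> 0) t = 0.
  elim: s t => //= j s IH t; rewrite /lint; under eq_Rintegral do rewrite IH.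
  by rewrite Rintegral_cst// mul0r.
have fi0 : lint i (f \o clamp a b) = fun=> 0.
  apply/funext => t; rewrite -(fi (clamp a b t)); last exact: clamp_cbox.
  by apply: eq_Rintegral => x /set_mem/= xab; rewrite clamp_upd.
have : i \in enum 'I_n by rewrite mem_enum.
move=> /splitPr[s1 s2]; rewrite /mint foldr_cat /= -/(mint s2 _) -mint_lint; last exact: cf.
rewrite fi0; rewrite (_ : mint s2 _ = fun=> 0); last by apply/funext => t; exact: zero.
exact: zero.
Qed.

Lemma bcont_cst (c : R) : bcont (fun=> c).
Proof. by apply: continuous_subspaceT => x; exact: cst_continuous. Qed.

Lemma bcontD f g : bcont f -> bcont g -> bcont (fun t => f t + g t).
Proof.
move=> /(clamp_continuousP ab) cf /(clamp_continuousP ab) cg;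
  apply/(clamp_continuousP ab) => t.
exact: (cvgD (cf t) (cg t)).
Qed.

Lemma bcontM f g : bcont f -> bcont g -> bcont (fun t => f t * g t).
Proof.
move=> /(clamp_continuousP ab) cf /(clamp_continuousP ab) cg;
  apply/(clamp_continuousP ab) => t.
exact: (cvgM (cf t) (cg t)).
Qed.

Lemma bcontB f g : bcont f -> bcont g -> bcont (fun t => f t - g t).
Proof.
move=> /(clamp_continuousP ab) cf /(clamp_continuousP ab) cg;
  apply/(clamp_continuousP ab) => t.
exact: (cvgB (cf t) (cg t)).
Qed.

Lemma bcont_sum (I : Type) (r : seq I) (F : I -> 'rV[R]_n -> R) :
  (forall i, bcont (F i)) -> bcont (fun t => \sum_(i <- r) F i t).
Proof.
move=> cF; elim: r => [|i r IH].
  by under eq_fun do rewrite big_nil; exact: bcont_cst.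
by under eq_fun do rewrite big_cons; exact: bcontD.
Qed.

Lemma iint_cst c : iint a b (fun=> c) = c * iint a b (fun=> 1).
Proof.
have z : iint a b (fun=> 0) = 0.
  have := @iint_lin (fun=> 0) (fun=> 0) 1 (@bcont_cst 0) (@bcont_cst 0).
  by rewrite mulr0 addr0 mul1r; lra.
have := @iint_lin (fun=> 0) (fun=> 1) c (@bcont_cst 0) (@bcont_cst 1).
by rewrite add0r mulr1 z add0r.
Qed.

Lemma iint_sum (I : Type) (r : seq I) (F : I -> 'rV[R]_n -> R) :
  (forall i, bcont (F i)) ->
  iint a b (fun t => \sum_(i <- r) F i t) = \sum_(i <- r) iint a b (F i).
Proof.
move=> cF; elim: r => [|i r IH].
  by under eq_fun do rewrite big_nil; rewrite big_nil iint_cst mul0r.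
under eq_fun do rewrite big_cons.
rewrite big_cons -IH -[X in _ + X]mul1r -iint_lin//; last exact: bcont_sum.
by apply: eq_iint => t _; rewrite mul1r.
Qed.
End IteratedIntegral.

(** * One-sided derivatives *)
Section DerivWithin.
Context {R : realType}.
Implicit Types (D : set R) (g : R -> R) (x l c : R).

(** Limits along [dfilter] determine [deriv_within] only if the filter is proper, that is, if
    arbitrarily small nonzero increments stay in the interval. There is room on the right unless
    [x = b], where the left side serves. *)
Lemma dfilter_itv_proper (a b x : R) : a < b -> x \in `[a, b] ->
  ProperFilter (dfilter `[a, b] x).
Proof.
move=> ab; rewrite in_itv/= => /andP[ax xb]; apply: Build_ProperFilter_ex => P.
move=> /nbhs_ballP[e /= e0 He].
have [xb'|bx] := ltP x b.
  exists (Num.min (e / 2) (b - x)); apply: He => /=.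
  - rewrite /ball/= sub0r normrN gtr0_norm; last by rewrite lt_min; apply/andP; split; lra.
    by rewrite gt_min; apply/orP; left; lra.
  - by rewrite gt_eqF// lt_min; apply/andP; split; lra.
  - rewrite in_itv/=; have : Num.min (e / 2) (b - x) <= b - x by rewrite ge_min lexx orbT.
    have : 0 < Num.min (e / 2) (b - x) by rewrite lt_min; apply/andP; split; lra.
    by move=> ? ?; apply/andP; split; lra.
exists (- Num.min (e / 2) (b - a)); apply: He => /=.
- rewrite /ball/= sub0r opprK gtr0_norm; last by rewrite lt_min; apply/andP; split; lra.
  by rewrite gt_min; apply/orP; left; lra.
- by rewrite oppr_eq0 gt_eqF// lt_min; apply/andP; split; lra.
- rewrite in_itv/=; have : Num.min (e / 2) (b - a) <= b - a by rewrite ge_min lexx orbT.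
  have : 0 < Num.min (e / 2) (b - a) by rewrite lt_min; apply/andP; split; lra.
  by move=> ? ?; apply/andP; split; lra.
Qed.

Lemma deriv_within_cvg D g x l : ProperFilter (dfilter D x) ->
  dquot g x @ dfilter D x --> l -> deriv_within D g x = l.
Proof. by move=> FF; exact: cvg_lim. Qed.

Lemma derivable_within_cvg D g x : derivable_within D g x ->
  dquot g x @ dfilter D x --> deriv_within D g x.
Proof. by []. Qed.

Lemma is_derive_dquot D g x l : is_derive x 1 g l -> dquot g x @ dfilter D x --> l.
Proof.
move=> [dg <-]; apply: cvg_within_filter.
rewrite (_ : dquot g x = fun h => h^-1 *: (g (h *: 1 + x) - g x)); first exact: dg.
by apply/funext => h; rewrite /dquot /GRing.scale/= mulr1 (addrC h).
Qed.

(** Small increments stay in a neighbourhood [D] of [x], so the relative and the ordinary derivative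
    agree. This gives access to the mean value theorem and to integration by parts. *)
Lemma dquot_is_derive D g x l : nbhs x D -> dquot g x @ dfilter D x --> l ->
  is_derive x 1 g l.
Proof.
move=> xD gl.
have gl' : (fun h => h^-1 *: (g (h *: 1 + x) - g x)) @ (0 : R)^' --> l.
  rewrite (_ : (fun h => _) = dquot g x); last first.
    by apply/funext => h; rewrite /dquot /GRing.scale/= mulr1 (addrC h).
  have D0 : \forall h \near (0 : R)^', D (x + h).
    apply: (@cvg_within _ (nbhs (0 : R))).
    have c : x + h @[h --> (0 : R)] --> x.
      by rewrite -[X in _ --> X]addr0; apply: cvgD; [exact: cvg_cst|exact: cvg_id].
    exact: c.
  move=> A /gl/= hA.
  by apply: filterS2 D0 hA => h Dh; exact.
split; first by apply/cvg_ex; exists l.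
exact: cvg_lim gl'.
Qed.

Lemma dquot_lin D g1 g2 x l1 l2 c :
  Filter (dfilter D x) ->
  dquot g1 x @ dfilter D x --> l1 -> dquot g2 x @ dfilter D x --> l2 ->
  dquot (fun s => g1 s + c * g2 s) x @ dfilter D x --> l1 + c * l2.
Proof.
move=> FF h1 h2.
rewrite (_ : dquot _ x = fun h => dquot g1 x h + c * dquot g2 x h); last first.
  by apply/funext => h; rewrite /dquot; ring.
by apply: cvgD => //; apply: cvgM => //; exact: cvg_cst.
Qed.

End DerivWithin.

(** * First variation of the integrand *)
Lemma mean_value_step {R : realType} (f df : R -> R) (x d : R) :
  (forall s : R, is_derive s 1 f (df s)) ->
  exists2 s, `|s - x| <= `|d| & f (x + d) - f x = d * df s.
Proof.
move=> fdf.
have cf (c e : R) : {within `[c, e], continuous f}.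
  apply: continuous_subspaceT => s; apply/differentiable_continuous/derivable1_diffP.
  by have [] := fdf s.
have [d0|d0|->] := ltgtP d 0; last by exists x; rewrite ?subrr ?addr0 ?normr0 ?mul0r ?subrr.
- have xd : x + d < x by lra.
  have [s] := MVT xd (fun s _ => fdf s) (cf _ _).
  rewrite in_itv/= => /andP[s1 s2] E; exists s; last by rewrite -opprB E; ring.
  by rewrite !ltr0_norm//; lra.
- have xd : x < x + d by lra.
  have [s] := MVT xd (fun s _ => fdf s) (cf _ _).
  rewrite in_itv/= => /andP[s1 s2] E; exists s; last by rewrite E; ring.
  by rewrite !gtr0_norm//; lra.
Qed.

(** Lists of variables need an equality test, which is supplied classically. *)
HB.instance Definition _ (n N : nat) := gen_eqMixin (fvar n N).

Section Variables.
Context {R : realType} {n N : nat} (a b : 'rV[R]_n).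
Implicit Types (z y : args R n N) (c : fvar n N) (cs : seq (fvar n N)).

(** The coordinates of [t] are the only ones confined to an interval; changing any other variable
    stays in [Fdom], and its derivative is two-sided. *)
Definition tvar c : bool := if c is Vt _ then true else false.

Lemma getv_setv z c s : getv (setv z c s) c = s.
Proof. by case: c => [i|k|k i|k i] /=; rewrite mxE !eqxx. Qed.

Lemma getv_setv_neq z c c' s : c' != c -> getv (setv z c s) c' = getv z c'.
Proof.
case: c => [i|k|k i|k i]; case: c' => [i'|k'|k' i'|k' i'] //= /eqP cc'; rewrite mxE//.
- by case: eqP => // E; case: cc'; rewrite E.
- by case: eqP => // E; case: cc'; rewrite E.
- by case: eqP => // E /=; case: eqP => // E'; case: cc'; rewrite E E'.
- by case: eqP => // E /=; case: eqP => // E'; case: cc'; rewrite E E'.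
Qed.

Lemma args_ext z z' : (forall c, getv z c = getv z' c) -> z = z'.
Proof.
case: z => [[[t x] v] w]; case: z' => [[[t' x'] v'] w'] h.
have -> : t = t' by apply/rowP => i; exact: (h (Vt i)).
have -> : x = x' by apply/rowP => i; exact: (h (Vx i)).
have -> : v = v' by apply/matrixP => k i; exact: (h (Vv k i)).
by have -> : w = w' by apply/matrixP => k i; exact: (h (Vw k i)).
Qed.

Lemma setv_setv z c s s' : setv (setv z c s) c s' = setv z c s'.
Proof.
apply: args_ext => c'; have [->|cc'] := eqVneq c' c; first by rewrite !getv_setv.
by rewrite !getv_setv_neq.
Qed.

Lemma setv_getv z c : setv z c (getv z c) = z.
Proof.
apply: args_ext => c'; have [->|cc'] := eqVneq c' c; first by rewrite !getv_setv.
by rewrite !getv_setv_neq.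
Qed.

Lemma Fdom_setv z c s : ~~ tvar c -> Fdom a b z -> Fdom a b (setv z c s).
Proof. by case: c. Qed.

Lemma is_derive_setv G z c (s : R) : C1_F a b G -> ~~ tvar c -> Fdom a b z ->
  is_derive s 1 (fun s => G (setv z c s)) (pdF a b c G (setv z c s)).
Proof.
move=> [_ /(_ c) [dG _]] ct zF.
have := dG _ (Fdom_setv s ct zF); rewrite /derivable_within /pdF => /derivable_within_cvg.
rewrite getv_setv (_ : (fun s' => G (setv (setv z c s) c s')) = fun s => G (setv z c s));
  last first.
  by apply/funext => s'; rewrite setv_setv.
by apply: dquot_is_derive; case: c ct {dG} => //= *; exact: filterT.
Qed.

(* [z0] is the base point and [z] the current point of the path from [z0] to
   [z'] that moves the coordinates in [cs] one at a time. *)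
Lemma telescope G cs z0 z z' (d : fvar n N -> R) (e rho : R) :
  C1_F a b G -> uniq cs -> {in cs, forall c, ~~ tvar c} -> Fdom a b z ->
  (forall c, `|getv z c - getv z0 c| <= rho) ->
  {in cs, forall c, getv z c = getv z0 c} -> {in cs, forall c, `|d c| <= rho} ->
  {in cs, forall c, getv z' c = getv z c + d c} ->
  (forall c, c \notin cs -> getv z' c = getv z c) ->
  {in cs, forall c y, Fdom a b y -> (forall c', `|getv y c' - getv z0 c'| <= rho) ->
     `|pdF a b c G y - pdF a b c G z0| <= e} ->
  `|G z' - G z - \sum_(c <- cs) d c * pdF a b c G z0| <= \sum_(c <- cs) `|d c| * e.
Proof.
move=> CG; elim: cs z => [|c cs IH] z.
  move=> _ _ _ _ _ _ _ z'z _; rewrite !big_nil subr0.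
  by rewrite (_ : z' = z) ?subrr ?normr0//; apply: args_ext => c; exact: z'z.
move=> /= /andP[ccs ucs] tcs zF zrho zz0 drho zd z'z He.
have cin : c \in c :: cs by rewrite inE eqxx.
have csin c' : c' \in cs -> c' \in c :: cs by rewrite inE orbC => ->.
have csneq c' : c' \in cs -> c' != c by apply: contraTneq => ->.
pose z1 := setv z c (getv z c + d c).
have Hz1 : `|G z' - G z1 - \sum_(c <- cs) d c * pdF a b c G z0| <= \sum_(c <- cs) `|d c| * e.
  apply: IH => //.
  - by move=> c' /csin; exact: tcs.
  - by apply: Fdom_setv => //; exact: tcs.
  - move=> c'; have [->|cc'] := eqVneq c' c; last by rewrite getv_setv_neq.
    by rewrite getv_setv zz0// addrAC subrr add0r drho.
  - by move=> c' c'cs; rewrite getv_setv_neq ?csneq// zz0// csin.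
  - by move=> c' /csin; exact: drho.
  - by move=> c' c'cs; rewrite getv_setv_neq ?csneq// zd// csin.
  - move=> c' c'cs; have [->|cc'] := eqVneq c' c; first by rewrite getv_setv zd.
    by rewrite getv_setv_neq// z'z// inE negb_or cc'.
  - by move=> c' /csin; exact: He.
(* The step from [z] to [z1] is [d c] times a partial derivative at an intermediate point still
   within [rho] of [z0]; the remaining steps are the induction hypothesis. *)
have [s sd E] := mean_value_step (getv z c) (d c) (fun s => is_derive_setv s CG
  (tcs c cin) zF).
rewrite setv_getv -/z1 in E.
have Hy : `|pdF a b c G (setv z c s) - pdF a b c G z0| <= e.
  apply: He => //; first by apply: Fdom_setv => //; exact: tcs.
  move=> c'; have [->|cc'] := eqVneq c' c; last by rewrite getv_setv_neq.
  by rewrite getv_setv -(zz0 c)// (le_trans sd)// drho.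
rewrite !big_cons.
rewrite (_ : G z' - G z - _ = d c * (pdF a b c G (setv z c s) - pdF a b c G z0)
   + (G z' - G z1 - \sum_(c <- cs) d c * pdF a b c G z0)); last first.
  by rewrite mulrBr -E; ring.
apply: le_trans (ler_normD _ _) _; apply: lerD => //.
by rewrite normrM ler_wpM2l.
Qed.

(** A finite intersection, taken separately over the four families of variables. *)
Lemma near_fvar {T : Type} (F : set_system T) (P : fvar n N -> T -> Prop) :
  Filter F -> (forall c, \forall x \near F, P c x) -> \forall x \near F, forall c, P c x.
Proof.
move=> FF FP.
have F1 : \forall x \near F, forall i, P (Vt i) x by apply: filter_forall.
have F2 : \forall x \near F, forall k, P (Vx k) x by apply: filter_forall.
have F3 : \forall x \near F, forall k i, P (Vv k i) x.
  by apply: filter_forall => k; apply: filter_forall.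
have F4 : \forall x \near F, forall k i, P (Vw k i) x.
  by apply: filter_forall => k; apply: filter_forall.
by apply: filterS2 (filterI F1 F2) (filterI F3 F4) => x [? ?] [? ?]; case.
Qed.

Lemma nbhs_args z (A : set (args R n N)) : nbhs z A ->
  exists2 d : R, 0 < d & forall y, (forall c, `|getv z c - getv y c| < d) -> A y.
Proof.
move=> /nbhs_ballP[d /= d0 dA]; exists d => // y yz; apply: dA.
by split; [split; [split|]|]; split => // i j;
  [rewrite !(ord1 i); exact: (yz (Vt j))|rewrite !(ord1 i); exact: (yz (Vx j))
  |exact: (yz (Vv i j))|exact: (yz (Vw i j))].
Qed.

Lemma cbox_compact : compact (cbox a b).
Proof.
rewrite (_ : cbox a b = [set v | forall i, `[a 0 i, b 0 i]%classic (v ord0 i)]).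
  by apply: (@rV_compact R n (fun i => `[a 0 i, b 0 i]%classic)) => i;
    exact: segment_compact.
by apply/seteqP; split => v vab i; have := vab i; rewrite /= in_itv.
Qed.

(** [Fdom] is not compact, but only points near the graph of [z] over the compact box matter:
    continuity at [z t0] gives a radius valid for all [t] near [t0], and a covering argument makes
    one radius serve the whole box. *)
Lemma uniform_near_graph (D : args R n N -> R) (z : 'rV[R]_n -> args R n N) (e : R) :
  {within Fdom a b, continuous D} ->
  (forall c, {within cbox a b, continuous (fun t => getv (z t) c)}) ->
  (forall t, cbox a b t -> Fdom a b (z t)) -> 0 < e ->
  exists2 rho : R, 0 < rho & forall t y, cbox a b t -> Fdom a b y ->
    (forall c, `|getv y c - getv (z t) c| <= rho) -> `|D y - D (z t)| <= e.
Proof.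
move=> /subspace_continuousP cD cz zF e0.
have cov := (near_covering_withinP _).2 ((compact_near_coveringP _).1 cbox_compact).
have : \forall rho \near (0 : R)^'+, cbox a b `<=` [set t | forall y, Fdom a b y ->
   (forall c, `|getv y c - getv (z t) c| <= rho) -> `|D y - D (z t)| <= e].
  apply: (cov _ _ (fun rho t => forall y, Fdom a b y ->
   (forall c, `|getv y c - getv (z t) c| <= rho) -> `|D y - D (z t)| <= e)) => t0 t0ab.
  have e20 : 0 < e / 2 by rewrite divr_gt0.
  have /cvgrPdist_lt/(_ _ e20)/nbhs_args[d d0 Hd] := cD _ (zF _ t0ab).
  (* Half of [d] is spent going from [z t0] to [z t], the other half going from [z t] to [y]. *)
  have d20 : 0 < d / 2 by rewrite divr_gt0.
  have nt : \forall t \near t0, cbox a b t ->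
    forall c, `|getv (z t0) c - getv (z t) c| < d / 2.
    have : \forall t \near t0, forall c, cbox a b t ->
      `|getv (z t0) c - getv (z t) c| < d / 2.
      apply: (@near_fvar _ (nbhs t0) (fun c t => cbox a b t ->
        `|getv (z t0) c - getv (z t) c| < d / 2)) => c.
      have /subspace_continuousP/(_ _ t0ab)/cvgrPdist_lt/(_ _ d20) := cz c.
      by [].
    by apply: filterS => t h tab c; exact: h.
  have nr : \forall rho \near (0 : R)^'+, rho < d / 2 by exact: nbhs_right_lt.
  exists ([set t | cbox a b t -> forall c, `|getv (z t0) c - getv (z t) c| < d / 2],
          [set rho | rho < d / 2]) => //= -[t rho] [/= Ht Hr] tab y yF yz.
  have zt := Ht tab.
  have h1 : `|D (z t0) - D y| < e / 2.
    apply: Hd => // c; rewrite -(subrK (getv (z t) c) (getv (z t0) c)) -addrA.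
    rewrite (le_lt_trans (ler_normD _ _))// (_ : d = d / 2 + d / 2); last by lra.
    by rewrite ltr_leD// distrC (le_trans (yz c))// ltW.
  have h2 : `|D (z t0) - D (z t)| < e / 2.
    by apply: Hd; [move=> c; rewrite (lt_trans (zt c))//; lra|exact: zF].
  rewrite (_ : D y - D (z t) = (D (z t0) - D (z t)) - (D (z t0) - D y)); last by ring.
  by rewrite (le_trans (ler_normB _ _))//; lra.
move=> nr; have /filter_ex[rho [Hrho rho0]] : \forall rho \near (0 : R)^'+,
   (cbox a b `<=` [set t | forall y, Fdom a b y ->
   (forall c, `|getv y c - getv (z t) c| <= rho) -> `|D y - D (z t)| <= e]) /\ 0 < rho.
  by apply: filterI => //; exact: nbhs_right_gt.
by exists rho => // t y tab; exact: Hrho.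
Qed.

(** The same [d] works at all points of the box, which is what allows the estimate to be
    integrated. *)
Lemma first_variation G cs (z : 'rV[R]_n -> args R n N)
    (zh : R -> 'rV[R]_n -> args R n N) (zeta : 'rV[R]_n -> fvar n N -> R) (M e : R) :
  C1_F a b G -> uniq cs -> {in cs, forall c, ~~ tvar c} ->
  (forall c, {within cbox a b, continuous (fun t => getv (z t) c)}) ->
  (forall t, cbox a b t -> Fdom a b (z t)) ->
  (forall t, cbox a b t -> {in cs, forall c, `|zeta t c| <= M}) ->
  (forall h t, cbox a b t -> {in cs, forall c, getv (zh h t) c =
    getv (z t) c + h * zeta t c}) ->
  (forall h t c, cbox a b t -> c \notin cs -> getv (zh h t) c = getv (z t) c) ->
  0 < e ->
  exists2 d : R, 0 < d & forall h t, `|h| < d -> cbox a b t ->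
    `|G (zh h t) - G (z t) - h * \sum_(c <- cs) zeta t c * pdF a b c G (z t)| <= `|h| * e.
Proof.
move=> CG ucs tcs cz zF zM zh1 zh2 e0.
pose M1 := `|M| + 1.
have M10 : 0 < M1 by rewrite ltr_wpDl.
(* The [size cs] errors, each at most [|h| * M1 * e1], must add up to no more than [|h| * e]; the
   [+ 1] keeps the denominator positive when [cs] is empty. *)
pose e1 := e / ((size cs)%:R * M1 + 1).
have den0 : 0 < (size cs)%:R * M1 + 1 by rewrite ltr_wpDl// mulr_ge0// ltW.
have e10 : 0 < e1 by rewrite divr_gt0.
have [rho rho0 Hrho] : exists2 rho : R, 0 < rho & {in cs, forall c t y, cbox a b t ->
  Fdom a b y ->
    (forall c, `|getv y c - getv (z t) c| <= rho) ->
      `|pdF a b c G y - pdF a b c G (z t)| <= e1}.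
  elim: (cs) => [|c cs' [rho rho0 IH]]; first by exists 1.
  have [rho' rho'0 H'] := uniform_near_graph (CG.2 c).2 cz zF e10.
  exists (Num.min rho rho'); first by rewrite lt_min rho0.
  move=> c'; rewrite inE => /orP[/eqP ->|c'cs] t y tab yF yz.
    by apply: H' => // c''; rewrite (le_trans (yz c''))// ge_min lexx orbT.
  by apply: IH => // c''; rewrite (le_trans (yz c''))// ge_min lexx.
(* This makes every displacement [h * zeta t c] at most [rho] in absolute value. *)
exists (rho / M1); first by rewrite divr_gt0.
move=> h t hd tab.
have zM1 c : c \in cs -> `|zeta t c| <= M1.
  move=> ccs; rewrite (le_trans (zM t tab c ccs))// (le_trans (ler_norm M))//.
  by rewrite lerDl.
have := @telescope G cs (z t) (z t) (zh h t) (fun c => h * zeta t c) e1 rho CG ucs tcs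
  (zF _ tab).
rewrite (_ : \sum_(c <- cs) h * zeta t c * pdF a b c G (z t) =
  h * \sum_(c <- cs) zeta t c * pdF a b c G (z t)); last first.
  by rewrite mulr_sumr; apply: eq_bigr => c _; rewrite mulrA.
move=> T; apply: le_trans (T _ _ _ _ _ _) _ => //.
- by move=> c; rewrite subrr normr0 ltW.
- move=> c ccs; rewrite normrM -[leRHS](divfK (lt0r_neq0 M10)).
  by apply: ler_pM => //; [exact: ltW|exact: zM1].
- exact: zh1.
- by move=> c; exact: zh2.
- by move=> c ccs y; exact: Hrho.
apply: (@le_trans _ _ (\sum_(c <- cs) `|h| * M1 * e1)).
  rewrite !big_seq; apply: ler_sum => c ccs; rewrite normrM; apply: ler_wpM2r;
    first exact: ltW.
  by apply: ler_wpM2l => //; exact: zM1.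
rewrite big_const_seq count_predT iter_addr_0 -mulr_natl.
rewrite (_ : _ * _ = `|h| * ((size cs)%:R * M1 * e1)); last by ring.
apply: ler_wpM2l => //; rewrite /e1 mulrA ler_pdivrMr// mulrC ler_pM2l//.
by rewrite lerDl.
Qed.
End Variables.

(** * Test functions *)
Section Bump.
Context {R : realType}.

(** The square of the positive part: its double zero makes it C^1, which is all the smoothness that
    admissibility asks for. *)
Definition possq (y : R) : R := Num.max 0 y ^+ 2.

(** The difference quotient is off by at most [|h|], as is checked for each combination of signs of
    [y] and [y + h]. *)
Lemma is_derive_possq (y : R) : is_derive y 1 possq (2 * Num.max 0 y).
Proof.
apply: (@dquot_is_derive _ setT); first exact: filterT.
apply: cvg_within_filter.
apply/cvgrPdist_le => e e0; near=> h.
have he : `|h| <= e by near: h; apply: dnbhs0_le.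
have h0 : h != 0 by near: h; exact: nbhs_dnbhs_neq.
apply: le_trans he.
have -> : 2 * Num.max 0 y - dquot possq y h =
  h^-1 * (2 * Num.max 0 y * h - (possq (y + h) - possq y)).
  by rewrite /dquot; field.
rewrite normrM normfV ler_pdivrMl ?normr_gt0// -normrM -expr2 [leRHS]ger0_norm ?sqr_ge0// /possq.
rewrite ler_norml; apply/andP.
by case: (leP 0 y) => y0; case: (leP 0 (y + h)) => yh; split; nra.
Unshelve. all: by end_near. Qed.

Lemma possq_ge0 y : 0 <= possq y. Proof. exact: sqr_ge0. Qed.

Lemma possq_gt0 y : 0 < y -> 0 < possq y.
Proof. by move=> y0; rewrite /possq exprn_gt0// lt_max y0 orbT. Qed.

Lemma possq_le0 y : y <= 0 -> possq y = 0.
Proof. by move=> y0; rewrite /possq max_l// expr0n. Qed.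

Definition bump (c d x : R) : R := possq (x - c) * possq (d - x).
Definition dbump (c d x : R) : R :=
  possq (x - c) * (- (2 * Num.max 0 (d - x))) + possq (d - x) * (2 * Num.max 0 (x - c)).

Lemma is_derive_bump (c d x : R) : is_derive x 1 (bump c d) (dbump c d x).
Proof.
have h1 : is_derive x 1 (id - cst c : R -> R) 1.
  by apply: is_derive_eq; rewrite subr0.
have h2 : is_derive x 1 (cst d - id : R -> R) (-1).
  by apply: is_derive_eq; rewrite sub0r.
have h3 : is_derive x 1 (possq \o (id - cst c)) ((2 * Num.max 0 (x - c)) * 1).
  by apply: is_derive1_comp; exact: is_derive_possq.
have h4 : is_derive x 1 (possq \o (cst d - id)) ((2 * Num.max 0 (d - x)) * -1).
  by apply: is_derive1_comp; exact: is_derive_possq.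
rewrite (_ : bump c d = (possq \o (id - cst c)) * (possq \o (cst d - id)))//.
by apply: is_derive_eq; rewrite /dbump /GRing.scale/=; ring.
Qed.

Lemma continuous_pos (f : R -> R) : continuous f -> continuous (fun x => Num.max 0 (f x)).
Proof.
move=> cf x; apply: (@continuous_max R _ (fun=> 0) f); first exact: cst_continuous.
exact: cf.
Qed.

Lemma dbump_continuous (c d : R) : continuous (dbump c d).
Proof.
have c1 : continuous (fun x : R => Num.max 0 (x - c)).
  by apply: continuous_pos => x; apply: cvgB; [exact: cvg_id|exact: cvg_cst].
have c2 : continuous (fun x : R => Num.max 0 (d - x)).
  by apply: continuous_pos => x; apply: cvgB; [exact: cvg_cst|exact: cvg_id].
move=> x; rewrite /dbump /possq; apply: cvgD; apply: cvgM.
- exact: (cvgM (c1 x) (c1 x)).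
- by apply: cvgN; apply: cvgM; [exact: cvg_cst|exact: c2].
- exact: (cvgM (c2 x) (c2 x)).
- by apply: cvgM; [exact: cvg_cst|exact: c1].
Qed.

Lemma bump_continuous (c d : R) : continuous (bump c d).
Proof.
move=> x; apply/differentiable_continuous/derivable1_diffP.
by have [] := is_derive_bump c d x.
Qed.

Lemma bump_ge0 c d x : 0 <= bump c d x.
Proof. by rewrite mulr_ge0// possq_ge0. Qed.

Lemma bump_gt0 c d x : c < x < d -> 0 < bump c d x.
Proof. by move=> /andP[cx xd]; rewrite mulr_gt0// possq_gt0// subr_gt0. Qed.

Lemma bump_out c d x : ~~ (c < x < d) -> bump c d x = 0.
Proof.
rewrite negb_and -!leNgt => /orP[h|h]; rewrite /bump.
  by rewrite possq_le0 ?mul0r// subr_le0.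
by rewrite [X in _ * X]possq_le0 ?mulr0// subr_le0.
Qed.

Lemma dbump_out c d x : ~~ (c < x < d) -> dbump c d x = 0.
Proof.
rewrite negb_and -!leNgt => /orP[h|h]; rewrite /dbump.
  by rewrite possq_le0 ?subr_le0// [Num.max 0 (x - c)]max_l ?subr_le0//; ring.
by rewrite [X in _ + X * _]possq_le0 ?subr_le0// [Num.max 0 (d - x)]max_l ?subr_le0//; ring.
Qed.
End Bump.

(** * Tensor products of bumps *)

Section TestFunction.
Context {R : realType} {n : nat} (a b : 'rV[R]_n).
Hypothesis ab : forall i, a 0 i < b 0 i.
Variables (c d : 'rV[R]_n).
Hypothesis acdb : forall i, [/\ a 0 i < c 0 i, c 0 i < d 0 i & d 0 i < b 0 i].

Definition tensor (t : 'rV[R]_n) : R := \prod_j bump (c 0 j) (d 0 j) (t 0 j).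
(** The part of [tensor] that is constant along lines in direction [i]; operators acting in the
    [i]-th variable let it factor out. *)
Definition tensor_but (i : 'I_n) (t : 'rV[R]_n) : R :=
  \prod_(j | j != i) bump (c 0 j) (d 0 j) (t 0 j).

Lemma tensor_but_upd i t x : tensor_but i (upd t i x) = tensor_but i t.
Proof. by apply: eq_bigr => j ji; rewrite mxE (negbTE ji). Qed.

Lemma tensor_upd i t x : tensor (upd t i x) = bump (c 0 i) (d 0 i) x * tensor_but i t.
Proof. by rewrite /tensor (bigD1 i)//= updE -/(tensor_but i _) tensor_but_upd. Qed.

Lemma tensor_ge0 t : 0 <= tensor t.
Proof. by apply: prodr_ge0 => j _; exact: bump_ge0. Qed.

Lemma tensor_gt0 t : obox c d t -> 0 < tensor t.
Proof. by move=> h; apply: prodr_gt0 => j _; exact: bump_gt0. Qed.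

Lemma tensor_out t : ~ obox c d t -> tensor t = 0.
Proof.
move=> /existsNP[j /negP tj]; rewrite /tensor (bigD1 j)//= bump_out ?mul0r//.
Qed.

Lemma tensor_boundary t : ~ obox a b t -> tensor t = 0.
Proof.
move=> tab; apply: tensor_out; apply: contra_not tab => tcd j.
have [h1 h2 h3] := acdb j; have /andP[h4 h5] := tcd j.
by rewrite (lt_trans h1 h4) (lt_trans h5 h3).
Qed.

Lemma continuous_prod_bump (P : pred 'I_n) :
  continuous (fun t : 'rV[R]_n => \prod_(j | P j) bump (c 0 j) (d 0 j) (t 0 j)).
Proof.
apply: continuous_big => [|j _]; first exact: mul_continuous.
move=> t; apply: (@continuous_comp _ _ _ (fun t : 'rV[R]_n => t 0 j) (bump (c 0 j)
  (d 0 j))).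
  exact: coord_continuous.
exact: bump_continuous.
Qed.

Lemma pd_tensor i t : cbox a b t ->
  dquot (fun s => tensor (upd t i s)) (t 0 i) @ dfilter `[a 0 i, b 0 i] (t 0 i)
    --> dbump (c 0 i) (d 0 i) (t 0 i) * tensor_but i t.
Proof.
move=> tab; apply: is_derive_dquot.
rewrite (_ : (fun s => _) = bump (c 0 i) (d 0 i) * cst (tensor_but i t)); last first.
  by apply/funext => s; rewrite tensor_upd.
have h := is_derive_bump (c 0 i) (d 0 i) (t 0 i).
by apply: is_derive_eq; rewrite /GRing.scale/=; ring.
Qed.

Lemma pd_tensorE i t : cbox a b t ->
  pd a b tensor i t = dbump (c 0 i) (d 0 i) (t 0 i) * tensor_but i t.
Proof.
move=> tab; apply: deriv_within_cvg; last exact: pd_tensor.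
by apply: dfilter_itv_proper => //; rewrite in_itv/=; exact: tab.
Qed.

Lemma C1_tensor : C1_box a b tensor.
Proof.
split; first by apply: continuous_subspaceT; exact: continuous_prod_bump.
move=> i; split.
  by move=> t tab; apply/cvg_ex; eexists; exact: pd_tensor.
apply: (@subspace_eq_continuous _ _ R (fun t : 'rV[R]_n => dbump (c 0 i) (d 0 i)
  (t 0 i) * tensor_but i t)).
  by move=> t /set_mem tab; exact/esym/pd_tensorE.
have cd : continuous (fun t : 'rV[R]_n => dbump (c 0 i) (d 0 i) (t 0 i)).
  move=> t; apply: (@continuous_comp _ _ _ (fun t : 'rV[R]_n => t 0 i) (dbump (c 0 i)
    (d 0 i))).
    exact: coord_continuous.
  exact: dbump_continuous.
apply: continuous_subspaceT => t.
exact: (cvgM (cd t) (@continuous_prod_bump (fun j => j != i) t)).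
Qed.
End TestFunction.

(** * Duality and integration by parts *)
Section KernelOperator.
Context {R : realType} {n : nat} (a b : 'rV[R]_n).
Hypothesis ab : forall i, a 0 i < b 0 i.
Notation mu := (@lebesgue_measure R).
Notation bcont f := {within cbox a b, continuous f}.
Variables (i : 'I_n) (kg : R -> R).
Hypothesis ikg : mu.-integrable `]0, b 0 i - a 0 i[ (EFin \o kg).
Implicit Types (f g : 'rV[R]_n -> R) (p q : R).

Notation kk p q := (kernel2 (b 0 i - a 0 i) kg p q).

Lemma coord_itv t : cbox a b t -> t 0 i \in `[a 0 i, b 0 i].
Proof. by move=> tab; rewrite in_itv/=; exact: tab. Qed.

(** For [t] in the box both segments of integration stay in the box. Hence [f] may be replaced by
    [f \o clamp a b]. *)
Lemma eq_Kop p q f g t : (forall t, cbox a b t -> f t = g t) -> cbox a b t ->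
  Kop a b kg p q i f t = Kop a b kg p q i g t.
Proof.
move=> fg tab; have /andP[at_ tb] := tab i.
congr (_ * _ + _ * _); apply: eq_Rintegral => y /set_mem/=;
  rewrite in_itv/= => /andP[y1 y2];
  rewrite fg//; apply: upd_cbox => //; rewrite in_itv/=.
- by rewrite y1 (le_trans y2).
- by rewrite y2 (le_trans at_).
Qed.

Lemma KopE p q f t : bcont f -> cbox a b t ->
  Kop a b kg p q i f t =
  \int[mu]_(y in `[a 0 i, b 0 i]) (kk p q (t 0 i - y) * f (upd t i y)).
Proof.
move=> /(clamp_continuousP ab) cf tab.
rewrite (@eq_Kop _ _ _ (f \o clamp a b))//; last by move=> t' t'ab; rewrite /= clamp_id.
rewrite /Kop (kernel2E (g := fun y => (f \o clamp a b) (upd t i y)) _ _ erefl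
  (coord_itv tab) ikg).
  by apply: eq_Rintegral => y /set_mem/= yab; rewrite clamp_upd// clamp_id.
exact: line_continuous.
Qed.

Lemma Kop_lin p q f g (e : R) t : bcont f -> bcont g -> cbox a b t ->
  Kop a b kg p q i (fun t => f t + e * g t) t =
  Kop a b kg p q i f t + e * Kop a b kg p q i g t.
Proof.
move=> cf cg tab.
have key h : bcont h -> Kop a b kg p q i h t =
   \int[mu]_(y in `[a 0 i, b 0 i]) (kk p q (t 0 i - y) * (h \o clamp a b) (upd t i y)).
  move=> ch; rewrite KopE//; apply: eq_Rintegral => y /set_mem/= yab.
  by rewrite clamp_upd// clamp_id.
have int h : bcont h -> mu.-integrable `[a 0 i, b 0 i]
    (EFin \o (fun y => kk p q (t 0 i - y) * (h \o clamp a b) (upd t i y))).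
  move=> /(clamp_continuousP ab) ch.
  apply: (@conv_integrable _ _ (fun y => (h \o clamp a b) (upd t i y))).
    exact: kernel2_integrable.
  exact: line_continuous.
have ceg : bcont (fun t => e * g t) by apply: (bcontM ab) => //; exact: bcont_cst.
rewrite key; last exact: (bcontD ab).
rewrite (key f)// (key g)// -RintegralZl//; last exact: int.
rewrite -RintegralD//; [|exact: int|].
  by apply: eq_Rintegral => y _ /=; ring.
have := int _ ceg; congr (_.-integrable _ _); apply/funext => y /=; congr EFin; ring.
Qed.

Lemma Kop_dual p q f g t : bcont f -> bcont g -> cbox a b t ->
  lint a b i (fun t => f t * Kop a b kg p q i g t) t =
  lint a b i (fun t => Kop a b kg q p i f t * g t) t.
Proof.
move=> cf cg tab.
have [cf' cg'] := ((clamp_continuousP ab _).1 cf, (clamp_continuousP ab _).1 cg).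
pose F y := (f \o clamp a b) (upd t i y); pose G y := (g \o clamp a b) (upd t i y).
have FE y : y \in `[a 0 i, b 0 i] -> f (upd t i y) = F y.
  by move=> yab; rewrite /F /= clamp_upd// clamp_id.
have GE y : y \in `[a 0 i, b 0 i] -> g (upd t i y) = G y.
  by move=> yab; rewrite /G /= clamp_upd// clamp_id.
have := @conv_dual _ (kk p q) F G (a 0 i) (b 0 i) (kernel2_integrable p q ikg)
  (line_continuous (i:=i) (t:=t) cf') (line_continuous (i:=i) (t:=t) cg').
rewrite /lint => E; transitivity (\int[mu]_(x in `[a 0 i, b 0 i])
    (F x * \int[mu]_(y in `[a 0 i, b 0 i]) (kk p q (x - y) * G y))).
  apply: eq_Rintegral => x /set_mem/= xab; rewrite FE// KopE//; last exact: upd_cbox.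
  congr (_ * _); apply: eq_Rintegral => y /set_mem/= yab.
  by rewrite updE upd_upd GE.
rewrite E; apply: eq_Rintegral => y /set_mem/= yab; rewrite GE// KopE//;
  last exact: upd_cbox.
congr (_ * _); apply: eq_Rintegral => x /set_mem/= xab.
by rewrite updE upd_upd FE// kernel2C sub0r opprB.
Qed.
End KernelOperator.

(** * Integration by parts along coordinate lines *)

Section IBP.
Context {R : realType} {n : nat} (a b : 'rV[R]_n).
Hypothesis ab : forall i, a 0 i < b 0 i.

Lemma line_derive V i t : C1_box a b V -> cbox a b t ->
  [/\ {within `[a 0 i, b 0 i], continuous (fun x => pd a b V i (upd t i x))},
      derivable_oo_LRcontinuous (fun x => V (upd t i x)) (a 0 i) (b 0 i) &
      {in `]a 0 i, b 0 i[, derive1 (fun x => V (upd t i x)) =1 (fun x => pd a b V i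
        (upd t i x))}].
Proof.
move=> [cV /(_ i)[dV cdV]] tab.
have dd x : x \in `]a 0 i, b 0 i[ -> is_derive x 1 (fun x => V (upd t i x)) (pd a b V i
  (upd t i x)).
  move=> xab.
  have xab' : x \in `[a 0 i, b 0 i] by exact: subset_itv_oo_cc.
  have := dV _ (upd_cbox tab xab'); rewrite /pd => /derivable_within_cvg.
  rewrite updE (_ : (fun s => V (upd (upd t i x) i s)) = fun s => V (upd t i s));
    last first.
    by apply/funext => s; rewrite upd_upd.
  apply: dquot_is_derive.
  have : nbhs x `]a 0 i, b 0 i[%classic by exact: near_in_itvoo.
  by apply: filterS => y; exact: subset_itv_oo_cc.
split; first exact: line_continuous_within.
  have /(continuous_within_itvP _ (ab i))[_ h1 h2] := line_continuous_within
    (i := i) ab cV tab.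
  by split => // x /dd[].
by move=> x xab; rewrite derive1E; have [_ ->] := dd x xab.
Qed.

Lemma lint_by_parts V W i t : C1_box a b V -> C1_box a b W -> cbox a b t ->
  W (upd t i (a 0 i)) = 0 -> W (upd t i (b 0 i)) = 0 ->
  lint a b i (fun t => V t * pd a b W i t) t = - lint a b i (fun t => pd a b V i t * W t) t.
Proof.
move=> CV CW tab Wa Wb.
have [cv dV EV] := line_derive i CV tab; have [cw dW EW] := line_derive i CW tab.
by rewrite /lint (Rintegration_by_parts (ab i) cv dV EV cw dW EW) Wa Wb !mulr0 subrr sub0r.
Qed.
End IBP.

(** * Linearity on the box and the fundamental lemma of the calculus of variations *)

Section Fundamental.
Context {R : realType} {n : nat} (a b : 'rV[R]_n).
Hypothesis ab : forall i, a 0 i < b 0 i.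
Notation bcont f := {within cbox a b, continuous f}.
Implicit Types f g : 'rV[R]_n -> R.

Lemma bcont_bounded f : bcont f -> exists2 M : R, 0 <= M & forall t, cbox a b t ->
  `|f t| <= M.
Proof.
move=> cf.
have := compact_bounded (continuous_compact cf (cbox_compact (a := a) (b := b))).
case=> M [_ HM]; exists (`|M| + 1) => [|t tab]; first exact: addr_ge0.
by apply: HM; [rewrite (le_lt_trans (ler_norm M))// ltrDl|exists t].
Qed.

Lemma eq_bcont f g : (forall t, cbox a b t -> f t = g t) -> bcont f -> bcont g.
Proof. by move=> fg; apply: subspace_eq_continuous => t /set_mem; exact: fg. Qed.

Lemma lint_lin i f g c t : bcont f -> bcont g -> cbox a b t ->
  lint a b i (fun t => f t + c * g t) t = lint a b i f t + c * lint a b i g t.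
Proof.
move=> /(clamp_continuousP ab) cf /(clamp_continuousP ab) cg tab.
have E h : lint a b i h t = mint a b [:: i] (h \o clamp a b) t.
  by apply: (@mint_eq_cbox _ _ _ _ [:: i]) => // t' t'ab; rewrite /= clamp_id.
by rewrite !E -mint_lin.
Qed.

Lemma lintZ i f c t : bcont f -> cbox a b t ->
  lint a b i (fun t => c * f t) t = c * lint a b i f t.
Proof.
move=> cf tab; have := lint_lin i c (@bcont_cst _ _ a b 0) cf tab.
have -> : lint a b i (fun=> 0) t = 0 by rewrite /lint Rintegral_cst// mul0r.
by rewrite add0r => <-; apply: eq_Rintegral => x _; rewrite add0r.
Qed.

Lemma iint_line_eq f g i : bcont f -> bcont g ->
  (forall t, cbox a b t -> lint a b i f t = lint a b i g t) -> iint a b f = iint a b g.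
Proof.
move=> cf cg fg; apply/eqP; rewrite -subr_eq0 -mulN1r -(iint_lin ab)//; apply/eqP.
apply: (iint_line0 ab (i := i)) => [|t tab].
  by apply: (bcontD ab) => //; apply: (bcontM ab) => //; exact: bcont_cst.
by rewrite lint_lin// fg// mulN1r subrr.
Qed.

Lemma iintZ f c : bcont f -> iint a b (fun t => c * f t) = c * iint a b f.
Proof.
move=> cf; have := @iint_lin _ _ _ _ ab (fun=> 0) f c (@bcont_cst _ _ a b 0) cf.
rewrite (iint_cst ab 0) mul0r add0r => <-; apply: (eq_iint ab) => t _.
by rewrite add0r.
Qed.

Lemma C1_box_lin f g (e : R) : C1_box a b f -> C1_box a b g ->
  (forall i t, cbox a b t ->
     pd a b (fun t => f t + e * g t) i t = pd a b f i t + e * pd a b g i t) /\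
  C1_box a b (fun t => f t + e * g t).
Proof.
move=> [cf Cf] [cg Cg].
have dq i t : cbox a b t ->
    dquot (fun s => f (upd t i s) + e * g (upd t i s)) (t 0 i) @ dfilter `[a 0 i, b 0 i]
      (t 0 i)
    --> pd a b f i t + e * pd a b g i t.
  move=> tab; apply: dquot_lin.
  - exact: derivable_within_cvg ((Cf i).1 t tab).
  - exact: derivable_within_cvg ((Cg i).1 t tab).
have pdE i t : cbox a b t ->
    pd a b (fun t => f t + e * g t) i t = pd a b f i t + e * pd a b g i t.
  move=> tab; apply: deriv_within_cvg; last exact: dq.
  exact: dfilter_itv_proper (ab i) (coord_itv i tab).
have ce h : bcont h -> bcont (fun t => e * h t).
  by move=> ch; apply: (bcontM ab) => //; exact: bcont_cst.
split => //; split; first by apply: (bcontD ab) => //; exact: ce.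
move=> i; split; first by move=> t tab; apply/cvg_ex; eexists; exact: dq.
apply: (@eq_bcont (fun t => pd a b f i t + e * pd a b g i t)).
  by move=> t tab; rewrite pdE.
by apply: (bcontD ab); [exact: (Cf i).2|apply: ce; exact: (Cg i).2].
Qed.

(** If [g t] were positive, a bump supported where [g] is positive would give a continuous
    nonnegative integrand that is positive at [t], hence a positive integral. *)
Lemma fundamental_le0 g t : bcont g -> obox a b t ->
  (forall c d : 'rV[R]_n, (forall i, [/\ a 0 i < c 0 i, c 0 i < d 0 i & d 0 i < b 0 i]) ->
     iint a b (fun t => g t * tensor c d t) = 0) -> g t <= 0.
Proof.
move=> cg tab H; rewrite leNgt; apply/negP => gt0.
have tab' := obox_cbox tab.
have [e e0 He] : exists2 e : R, 0 < e & forall y, cbox a b y ->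
  (forall j, `|t 0 j - y 0 j| < e) -> 0 < g y.
  have /subspace_continuousP/(_ _ tab')/cvgrPdist_lt/(_ _ gt0) := cg.
  move=> /nbhs_ballP[e /= e0 He]; exists e => // y yab ty.
  have : `|g t - g y| < g t.
    by apply: He => //; split => // i j; rewrite !ord1; exact: ty.
  by rewrite ltr_distlC => /andP[]; rewrite subrr.
(* Halving makes the inequalities strict: the small box lies strictly inside the large one and
   within distance [e] of [t]. *)
pose r j := Num.min e (Num.min (t 0 j - a 0 j) (b 0 j - t 0 j)) / 2.
have rP j : [/\ 0 < r j, r j < e, r j < t 0 j - a 0 j & r j < b 0 j - t 0 j].
  have /andP[h1 h2] := tab j.
  rewrite /r; set m := Num.min e _; have m0 : 0 < m by rewrite !lt_min e0 !subr_gt0 h1.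
  have [m1 m2 m3] : [/\ m <= e, m <= t 0 j - a 0 j & m <= b 0 j - t 0 j].
    by split; rewrite !ge_min lexx ?orbT.
  by split; lra.
pose c : 'rV[R]_n := \row_j (t 0 j - r j); pose d : 'rV[R]_n := \row_j (t 0 j + r j).
have acdb i : [/\ a 0 i < c 0 i, c 0 i < d 0 i & d 0 i < b 0 i].
  by have [h1 h2 h3 h4] := rP i; rewrite !mxE; split; lra.
have := H c d acdb; apply/eqP; rewrite gt_eqF//.
apply: (iint_gt0 ab (t := t)) => //.
- by apply: (bcontM ab) => //; exact: (C1_tensor ab c d).1.
- move=> y yab; have [ycd|ycd] := pselect (obox c d y); last first.
    by rewrite tensor_out ?mulr0.
  rewrite mulr_ge0 ?tensor_ge0// ltW// He// => j.
  have := ycd j; have [h1 h2 h3 h4] := rP j; rewrite !mxE => /andP[h5 h6].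
  by rewrite ltr_norml; apply/andP; split; lra.
- rewrite mulr_gt0// tensor_gt0// => j; have [h1 h2 h3 h4] := rP j.
  by rewrite !mxE; apply/andP; split; lra.
Qed.

Lemma fundamental_lemma g t : bcont g -> obox a b t ->
  (forall c d : 'rV[R]_n, (forall i, [/\ a 0 i < c 0 i, c 0 i < d 0 i & d 0 i < b 0 i]) ->
     iint a b (fun t => g t * tensor c d t) = 0) -> g t = 0.
Proof.
move=> cg tab H; apply/eqP; rewrite eq_le fundamental_le0//=.
rewrite -oppr_le0 -mulN1r.
apply: (@fundamental_le0 (fun t => -1 * g t)) => //.
  by apply: (bcontM ab) => //; exact: bcont_cst.
move=> c d acdb; have := H c d acdb => E.
rewrite -[RHS](mulr0 (-1)) -E -iintZ; last first.
  by apply: (bcontM ab) => //; exact: (C1_tensor ab c d).1.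
by apply: (eq_iint ab) => y _; rewrite mulrA.
Qed.

Lemma bcont_graph (N : nat) (D : args R n N -> R) (z : 'rV[R]_n -> args R n N) :
  {within Fdom a b, continuous D} ->
  (forall c, bcont (fun t => getv (z t) c)) ->
  (forall t, cbox a b t -> Fdom a b (z t)) -> bcont (fun t => D (z t)).
Proof.
move=> cD cz zF; apply/(clamp_continuousP ab).
apply: (@continuous_comp_within _ _ _ (Fdom a b) D (z \o clamp a b)) => //; last first.
  by move=> t; apply: zF; exact: clamp_cbox.
move=> t A /nbhs_args[e e0 eA].
have : \forall y \near t, forall c, `|getv (z (clamp a b t)) c - getv (z
  (clamp a b y)) c| < e.
  apply: (@near_fvar n N _ (nbhs t) (fun c y => `|getv (z (clamp a b t)) c - getv (z
    (clamp a b y)) c| < e)) => c.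
  have /(clamp_continuousP ab)/(_ t) cc := cz c.
  by move/(@cvgrPdist_lt R R _ (nbhs t)) : cc => /(_ _ e0).
by apply: filterS => y; exact: eA.
Qed.
End Fundamental.

(** * The Euler-Lagrange equation *)
Section EulerLagrange.
Context {R : realType} {n N : nat} (a b : 'rV[R]_n) (k : R -> R -> R)
  (alpha p1 q1 : 'I_n -> R).
Hypothesis ab : forall i, a 0 i < b 0 i.
Hypothesis ik : forall i, (@lebesgue_measure R).-integrable `]0, b 0 i - a 0 i[
                (EFin \o k (1 - alpha i)).
Notation mu := (@lebesgue_measure R).
Notation bcont f := {within cbox a b, continuous f}.
Notation B i := (Bop a b k (alpha i) (p1 i) (q1 i) i).

Lemma Bop_lin i (f g : 'rV[R]_n -> R) (e : R) t :
  C1_box a b f -> C1_box a b g -> cbox a b t ->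
  B i (fun t => f t + e * g t) t = B i f t + e * B i g t.
Proof.
move=> Cf Cg tab; have [pdE _] := C1_box_lin ab e Cf Cg.
transitivity (Kop a b (k (1 - alpha i)) (p1 i) (q1 i) i
    (fun t => pd a b f i t + e * pd a b g i t) t).
  by apply: eq_Kop => // t' t'ab; exact: pdE.
by rewrite Kop_lin//; [exact: (Cf.2 i).2|exact: (Cg.2 i).2].
Qed.

(** This is what keeps the perturbation admissible. Only the [i]-th bump is differentiated and
    convolved, and [dbump] vanishes off [[a 0 i, b 0 i]], as [conv_continuous] requires. *)
Lemma Bop_tensor_bcont i (c d : 'rV[R]_n) :
  (forall i, [/\ a 0 i < c 0 i, c 0 i < d 0 i & d 0 i < b 0 i]) ->
  bcont (B i (tensor c d)).
Proof.
move=> acdb; have Ct := C1_tensor ab c d.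
pose kp := kernel2 (b 0 i - a 0 i) (k (1 - alpha i)) (p1 i) (q1 i).
pose conv x := \int[mu]_(y in `[a 0 i, b 0 i]) (kp (x - y) * dbump (c 0 i) (d 0 i) y).
have ikp : mu.-integrable setT (EFin \o kp) by exact: kernel2_integrable.
apply: (@eq_bcont _ _ a b (fun t => conv (t 0 i) * tensor_but c d i t)).
  move=> t tab; rewrite /Bop KopE//; last exact: (Ct.2 i).2.
  rewrite -RintegralZr//; last by apply: conv_integrable => //; exact: dbump_continuous.
  apply: eq_Rintegral => y /set_mem/= yab; rewrite pd_tensorE//; last exact: upd_cbox.
  by rewrite updE tensor_but_upd mulrA.
have cc : continuous (fun t : 'rV[R]_n => conv (t 0 i)).
  move=> t; apply: (@continuous_comp _ _ _ (fun t : 'rV[R]_n => t 0 i) conv).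
    exact: coord_continuous.
  apply: conv_continuous => //; first exact: dbump_continuous.
  move=> y yab; apply: dbump_out; apply: contra yab => /andP[cy yd].
  have [h1 h2 h3] := acdb i.
  by rewrite in_itv/= (ltW (lt_trans h1 cy)) (ltW (lt_trans yd h3)).
apply: continuous_subspaceT => t.
exact: (cvgM (cc t) (@continuous_prod_bump _ _ c d (fun j => j != i) t)).
Qed.

Variables (psi u : 'rV[R]_n -> 'rV[R]_N) (kk : 'I_N) (c d : 'rV[R]_n).
Hypothesis acdb : forall i, [/\ a 0 i < c 0 i, c 0 i < d 0 i & d 0 i < b 0 i].
Hypothesis adm_u : admissible a b k alpha p1 q1 psi u.
Let eta := tensor c d.
Let Ceta : C1_box a b eta. Proof. exact: C1_tensor. Qed.

Definition perturb (h : R) (t : 'rV[R]_n) : 'rV[R]_N :=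
  u t + (h * eta t) *: delta_mx 0 kk.

Lemma comp_perturb h j :
  Defs.comp (perturb h) j = fun t => Defs.comp u j t + (h * (j == kk)%:R) * eta t.
Proof.
by apply/funext => t; rewrite /Defs.comp !mxE eqxx/= mulrAC.
Qed.

Lemma admissible_perturb h : admissible a b k alpha p1 q1 psi (perturb h).
Proof.
case: adm_u => Cu [Bu bu]; split; [|split].
- by move=> j; rewrite comp_perturb;
  have [] := C1_box_lin ab (h * (j == kk)%:R) (Cu j) Ceta.
- move=> i j; rewrite comp_perturb.
  apply: (@eq_bcont _ _ a b (fun t => B i (Defs.comp u j) t + h *
    (j == kk)%:R * B i eta t)).
    by move=> t tab; rewrite Bop_lin.
  apply: (bcontD ab) => //; apply: (bcontM ab); first exact: bcont_cst.
  exact: Bop_tensor_bcont.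
- by move=> t tab ntab; rewrite /perturb /eta
  (tensor_boundary acdb)// mulr0 scale0r addr0 bu.
Qed.

Let z (v : 'rV[R]_n -> 'rV[R]_N) := argu a b k alpha p1 q1 v.

(** The rate of change in [h] of each scalar argument of [F] along [perturb h], meant for the
    variables in [moved]; the component index is dropped because [moved] selects [kk]. *)
Definition direction (t : 'rV[R]_n) (w : fvar n N) : R :=
  match w with
  | Vt _ => 0
  | Vx _ => eta t
  | Vv _ i => B i eta t
  | Vw _ i => pd a b eta i t
  end.

Definition moved : seq (fvar n N) :=
  Vx kk :: [seq Vv kk i | i <- enum 'I_n] ++ [seq Vw kk i | i <- enum 'I_n].

Lemma uniq_moved : uniq moved.
Proof.
have injv : injective (@Vv n N kk) by move=> i j [].
have injw : injective (@Vw n N kk) by move=> i j [].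
rewrite /moved cons_uniq cat_uniq (map_inj_uniq injv)
  (map_inj_uniq injw) !enum_uniq mem_cat negb_or.
rewrite andbT -andbA; apply/and3P; split => //.
- by apply/mapP => -[].
- by apply/mapP => -[].
- by apply/hasPn => w /mapP[i _ ->]; apply/mapP => -[].
Qed.

Lemma mem_moved w : w \in moved =
  match w with Vt _ => false | Vx j => j == kk | Vv j _ => j == kk | Vw j _ => j == kk end.
Proof.
rewrite inE mem_cat; apply/idP/idP.
  by case/orP => [/eqP ->|/orP[/mapP[i _ ->]|/mapP[i _ ->]]].
case: w => [i|j|j i|j i] // /eqP ->; rewrite ?eqxx//.
  by rewrite map_f ?orbT// mem_enum.
by rewrite [X in _ || (_ || X)]map_f ?orbT// mem_enum.
Qed.

(** The arguments depend on [h] in an exactly affine way, since [B i] and the partial derivatives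
    are linear; a remainder arises only from [F]. *)
Lemma getv_perturb h t w : cbox a b t ->
  getv (z (perturb h) t) w =
    getv (z u t) w + (if w \in moved then h * direction t w else 0).
Proof.
case: adm_u => Cu _; rewrite mem_moved => tab; case: w => [i|j|j i|j i] /=.
- by rewrite addr0.
- rewrite !mxE eqxx/=; case: eqP => _; rewrite ?mulr1 ?mulr0//.
- by rewrite !mxE comp_perturb Bop_lin//; case: eqP => _; rewrite ?mulr1 ?mulr0 ?mul0r.
- rewrite !mxE comp_perturb; have [-> // _] := C1_box_lin ab (h * (j == kk)%:R) (Cu j) Ceta.
  by case: eqP => _; rewrite ?mulr1 ?mulr0 ?mul0r.
Qed.

Lemma bcont_coord v w : admissible a b k alpha p1 q1 psi v ->
  bcont (fun t => getv (z v t) w).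
Proof.
case=> Cv [Bv _]; case: w => [i|j|j i|j i] /=.
- by apply: continuous_subspaceT; exact: coord_continuous.
- exact: (Cv j).1.
- by under eq_fun do rewrite mxE; exact: Bv.
- by under eq_fun do rewrite mxE; exact: ((Cv j).2 i).2.
Qed.

Lemma bcont_direction w : bcont (fun t => direction t w).
Proof.
case: w => [i|j|j i|j i] /=.
- exact: bcont_cst.
- exact: Ceta.1.
- exact: Bop_tensor_bcont.
- exact: (Ceta.2 i).2.
Qed.

Variable F : 'rV[R]_n -> 'rV[R]_N -> 'M[R]_(N, n) -> 'M[R]_(N, n) -> R.
Hypothesis CF : C1_F a b (uncurryF F).
Notation J := (Jfun a b k alpha p1 q1 F).
Notation dF w := (dFu a b k alpha p1 q1 F w u).
Notation Fv v := (Fu a b k alpha p1 q1 F v).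

Lemma bcont_dFu w : bcont (dF w).
Proof.
apply: (@bcont_graph _ _ _ _ ab _ (pdF a b w (uncurryF F)) (z u)) => //.
- exact: (CF.2 w).2.
- by move=> w'; exact: bcont_coord.
Qed.

Lemma bcont_Fu v : admissible a b k alpha p1 q1 psi v -> bcont (Fv v).
Proof.
move=> av; apply: (@bcont_graph _ _ _ _ ab _ (uncurryF F) (z v)) => //.
- exact: CF.1.
- by move=> w'; exact: bcont_coord.
Qed.

Hypothesis extremal :
  (forall v, admissible a b k alpha p1 q1 psi v -> J u <= J v) \/
  (forall v, admissible a b k alpha p1 q1 psi v -> J v <= J u).

Lemma variation_eq0 : iint a b (fun t => \sum_(w <- moved) direction t w * dF w t) = 0.
Proof.
set S := fun t => \sum_(w <- moved) direction t w * dF w t.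
have cS : bcont S.
  apply: (bcont_sum ab) => w; apply: (bcontM ab); first exact: bcont_direction.
  exact: bcont_dFu.
(* [V] is the volume of the box, the factor gained when a constant bound is integrated. *)
set V := iint a b (fun=> 1).
have V0 : 0 <= V.
  have := @iint_le _ _ _ _ ab (fun=> 0) (fun=> 1) (@bcont_cst _ _ a b 0)
    (@bcont_cst _ _ a b 1).
  by rewrite (iint_cst ab 0) mul0r; apply => t _; exact: ler01.
have [M HM] : exists M : R, forall t, cbox a b t ->
  {in moved, forall w, `|direction t w| <= M}.
  elim: moved => [|w s [M HM]]; first by exists 0.
  have [M' _ HM'] := bcont_bounded (@bcont_direction w).
  exists (Num.max M M') => t tab w'; rewrite inE => /orP[/eqP ->|w's].
    by rewrite le_max HM' ?orbT.
  by rewrite le_max HM.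
have est (e : R) : 0 < e -> exists2 h : R, 0 < h & forall h', `|h'| = h ->
    `|J (perturb h') - J u - h' * iint a b S| <= h * (e * V).
  move=> e0.
  have [||||h t tab w wm|h t w tab wm||r r0 Hr] :=
    @first_variation _ _ _ a b (uncurryF F) moved (z u)
    (fun h => z (perturb h)) direction M e CF uniq_moved.
  - by move=> w; rewrite mem_moved; case: w.
  - by move=> w; exact: bcont_coord.
  - by [].
  - exact: HM.
  - by rewrite getv_perturb// wm.
  - by rewrite getv_perturb// (negbTE wm) addr0.
  - by [].
  (* Any fixed size below [r] would do: for given [e] only the sign of the increment is varied. *)
  exists (r / 2) => [|h hr]; first by rewrite divr_gt0.
  have ch := bcont_Fu (admissible_perturb h); have cu := bcont_Fu adm_u.
  have cD : bcont (fun t => Fv (perturb h) t + -1 * Fv u t).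
    by apply: (bcontD ab) => //; apply: (bcontM ab) => //; exact: bcont_cst.
  have cD' : bcont (fun t => Fv (perturb h) t + -1 * Fv u t + (- h) * S t).
    by apply: (bcontD ab) => //; apply: (bcontM ab) => //; exact: bcont_cst.
  have -> : J (perturb h) - J u - h * iint a b S = iint a b
      (fun t => Fv (perturb h) t + -1 * Fv u t + (- h) * S t).
    by rewrite !(iint_lin ab)// mulN1r mulNr.
  have bnd t : cbox a b t -> `|Fv (perturb h) t + -1 * Fv u t + (- h) * S t| <= r / 2 * e.
    by move=> tab; rewrite mulN1r mulNr -hr; apply: Hr => //; rewrite hr; lra.
  rewrite mulrA ler_norml -mulNr -!(iint_cst ab); apply/andP; split.
    apply: (iint_le ab) => //; first exact: bcont_cst.
    by move=> t /bnd; rewrite ler_norml => /andP[].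
  apply: (iint_le ab) => //; first exact: bcont_cst.
  by move=> t /bnd; rewrite ler_norml => /andP[].
have small (e : R) : 0 < e -> `|iint a b S| <= e * V.
  move=> e0; have [h h0 Hh] := est e e0.
  have := Hh h (gtr0_norm h0); have := Hh (- h) (etrans (normrN h) (gtr0_norm h0)).
  rewrite !ler_norml => /andP[h1 h2] /andP[h3 h4].
  have hI x y : h * x <= h * y -> x <= y by rewrite ler_pM2l.
  (* For a minimizer the increment of [J] is nonnegative for both signs: [h] gives the lower bound
     of the integral and [- h] the upper one. A maximizer exchanges these roles. *)
  case: extremal => ext.
    have e1 := ext _ (admissible_perturb h); have e2 := ext _ (admissible_perturb (- h)).
    by apply/andP; split; apply: hI; rewrite ?mulrN; lra.
  have e1 := ext _ (admissible_perturb h); have e2 := ext _ (admissible_perturb (- h)).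
  by apply/andP; split; apply: hI; rewrite ?mulrN; lra.
apply/eqP; rewrite -normr_le0; apply/ler_addgt0Pl => e e0; rewrite addr0.
(* Dividing by [V + 1] instead of [V] asks only for [0 <= V]. *)
have V1 : 0 < V + 1 by rewrite ltr_wpDl.
apply: le_trans (small (e / (V + 1)) _) _; first exact: divr_gt0.
by rewrite mulrAC ler_pdivrMr// ler_pM2l// lerDl.
Qed.

Hypothesis Cv : forall i, C1_box a b
  (Kop a b (k (1 - alpha i)) (q1 i) (p1 i) i (dF (Vv kk i))).
Hypothesis Cw : forall i, C1_box a b (dF (Vw kk i)).

Lemma variation_by_parts :
  iint a b (fun t => (dF (Vx kk) t - \sum_(i < n)
       (Aop a b k (alpha i) (q1 i) (p1 i) i (dF (Vv kk i)) t
        + pd a b (dF (Vw kk i)) i t)) * eta t) = 0.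
Proof.
have := variation_eq0.
pose A i := pd a b (Kop a b (k (1 - alpha i)) (q1 i) (p1 i) i (dF (Vv kk i))) i.
pose W i := pd a b (dF (Vw kk i)) i.
have cA i : bcont (A i) by exact: ((Cv i).2 i).2.
have cW i : bcont (W i) by exact: ((Cw i).2 i).2.
have ceta : bcont eta by exact: Ceta.1.
have cpd i : bcont (pd a b eta i) by exact: (Ceta.2 i).2.
have cB i : bcont (B i eta) by exact: Bop_tensor_bcont.
have cdF w : bcont (dF w) by exact: bcont_dFu.
(* [eta] vanishes on both faces orthogonal to direction [i], which removes the boundary terms
   below. *)
have bnd i t : cbox a b t -> eta (upd t i (a 0 i)) = 0 /\ eta (upd t i (b 0 i)) = 0.
  move=> tab; split; apply: (tensor_boundary acdb) => /(_ i); rewrite updE ltxx ?andbF//.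
(* Duality on each line takes the kernel off [pd a b eta i], which produces the swapped parameters
   [q1 i] and [p1 i]; the new factor is C^1 by [Cv], so integration by parts can follow. *)
have EB i : iint a b (fun t => B i eta t * dF (Vv kk i) t) =
  iint a b (fun t => -1 * (A i t * eta t)).
  transitivity (iint a b (fun t =>
      Kop a b (k (1 - alpha i)) (q1 i) (p1 i) i (dF (Vv kk i)) t * pd a b eta i t)).
    apply: (iint_line_eq ab (i := i)).
    - exact: (bcontM ab).
    - by apply: (bcontM ab) => //; exact: (Cv i).1.
    move=> t tab; rewrite -(Kop_dual ab (ik i))//.
    by apply: eq_Rintegral => x _; rewrite mulrC.
  apply: (iint_line_eq ab (i := i)).
  - by apply: (bcontM ab) => //; exact: (Cv i).1.
  - by apply: (bcontM ab); [exact: bcont_cst|exact: (bcontM ab)].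
  move=> t tab; have [b1 b2] := bnd i t tab; rewrite (lint_by_parts ab)// (lintZ ab)//;
    last exact: (bcontM ab).
  by rewrite mulN1r.
have EW i : iint a b (fun t => pd a b eta i t * dF (Vw kk i) t) =
  iint a b (fun t => -1 * (W i t * eta t)).
  apply: (iint_line_eq ab (i := i)).
  - exact: (bcontM ab).
  - by apply: (bcontM ab); [exact: bcont_cst|exact: (bcontM ab)].
  move=> t tab; have [b1 b2] := bnd i t tab.
  transitivity (lint a b i (fun t => dF (Vw kk i) t * pd a b eta i t) t).
    by apply: eq_Rintegral => x _; rewrite mulrC.
  rewrite (lint_by_parts ab)// (lintZ ab)//; last exact: (bcontM ab).
  by rewrite mulN1r.
rewrite (iint_sum ab); last by move=> w; apply: (bcontM ab) => //; exact: bcont_direction.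
rewrite /moved big_cons big_cat 2!big_map 2!big_enum /=.
rewrite (eq_bigr _ (fun i _ => EB i)) (eq_bigr _ (fun i _ => EW i)) => E.
(* The right-hand 0 is replaced by the transformed variation, whose terms are merged into one
   integral and compared pointwise with the left side. *)
rewrite -[RHS]E -!(iint_sum ab); last 2 first.
- by move=> i; apply: (bcontM ab); [exact: bcont_cst|exact: (bcontM ab)].
- by move=> i; apply: (bcontM ab); [exact: bcont_cst|exact: (bcontM ab)].
have c1 : bcont (fun t => \sum_(i < n) (-1 * (A i t * eta t))).
  by apply: (bcont_sum ab) => i; apply: (bcontM ab); [exact: bcont_cst|exact: (bcontM ab)].
have c2 : bcont (fun t => \sum_(i < n) (-1 * (W i t * eta t))).
  by apply: (bcont_sum ab) => i; apply: (bcontM ab); [exact: bcont_cst|exact: (bcontM ab)].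
rewrite -[X in _ = _ + (_ + X)]mul1r -(iint_lin ab)//.
rewrite -[X in _ = _ + X]mul1r -(iint_lin ab)//; last 2 first.
- exact: (bcontM ab).
- by apply: (bcontD ab) => //; apply: (bcontM ab) => //; exact: bcont_cst.
apply: (eq_iint ab) => t tab; rewrite mulrBl mulr_suml !mul1r mulrC; congr (_ + _).
rewrite -sumrN -big_split/=; apply: eq_bigr => i _; rewrite /Aop -/(A i) -/(W i); ring.
Qed.
End EulerLagrange.

Theorem mainTheorem4 (R : realType) (n N : nat) (a b : 'rV[R]_n)
  (k : R -> R -> R) (alpha p1 q1 : 'I_n -> R)
  (F : 'rV[R]_n -> 'rV[R]_N -> 'M[R]_(N, n) -> 'M[R]_(N, n) -> R)
  (psi u : 'rV[R]_n -> 'rV[R]_N) :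
  (forall i, a 0 i < b 0 i) ->
  (forall i, 0 < alpha i < 1) ->
  (forall i, (@lebesgue_measure R).-integrable `]0, b 0 i - a 0 i[
                (EFin \o k (1 - alpha i))) ->
  C2_F a b (uncurryF F) ->
  admissible a b k alpha p1 q1 psi u ->
  ((forall v, admissible a b k alpha p1 q1 psi v ->
      Jfun a b k alpha p1 q1 F u <= Jfun a b k alpha p1 q1 F v) \/
   (forall v, admissible a b k alpha p1 q1 psi v ->
      Jfun a b k alpha p1 q1 F v <= Jfun a b k alpha p1 q1 F u)) ->
  (forall i kk, C1_box a b
     (Kop a b (k (1 - alpha i)) (q1 i) (p1 i) i
        (dFu a b k alpha p1 q1 F (Vv kk i) u))) ->
  (forall i kk, C1_box a b (dFu a b k alpha p1 q1 F (Vw kk i) u)) ->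
  forall kk t, obox a b t ->
    \sum_(i < n)
       (Aop a b k (alpha i) (q1 i) (p1 i) i (dFu a b k alpha p1 q1 F (Vv kk i) u) t
        + pd a b (dFu a b k alpha p1 q1 F (Vw kk i) u) i t)
    = dFu a b k alpha p1 q1 F (Vx kk) u t.
Proof.
move=> ab _ ik [CF _] adm_u extremal Cv Cw kk t tab.
(* The [C1_box] hypotheses include continuity of the derivatives up to the boundary, so [G] is
   continuous on the closed box, as the fundamental lemma demands. *)
pose G t := dFu a b k alpha p1 q1 F (Vx kk) u t - \sum_(i < n)
  (Aop a b k (alpha i) (q1 i) (p1 i) i (dFu a b k alpha p1 q1 F (Vv kk i) u) t
   + pd a b (dFu a b k alpha p1 q1 F (Vw kk i) u) i t).
suff : G t = 0 by move/eqP; rewrite subr_eq0 => /eqP.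
apply: (fundamental_lemma ab) => // [|c d acdb].
  apply: (bcontB ab); first exact: (bcont_dFu ab adm_u CF).
  apply: (bcont_sum ab) => i; apply: (bcontD ab); first exact: ((Cv i kk).2 i).2.
  exact: ((Cw i kk).2 i).2.
exact: (variation_by_parts ab ik acdb adm_u CF extremal (Cv^~ kk) (Cw^~ kk)).
Qed.
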